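(* Let $V$ be a finite-dimensional complex vector space, $W<\mathrm{GL}(V)$ a finite (pseudo-)reflection group, $\mathcal{A}$ the arrangement of the hyperplanes fixed by the reflections of $W$, and $X=V\setminus\bigcup\mathcal{A}$. Let $W$ act diagonally on $X\times V$. Then the quotient bundle $(X\times V)/W\to X/W$ is holomorphically equivalent (as a holomorphic vector bundle over $X/W$) to the trivial bundle $(X/W)\times V\to X/W$.
   Context: A finite (pseudo-)reflection group is a finite subgroup $W<\mathrm{GL}(V)$ generated by finite-order endomorphisms fixing some hyperplane pointwise (reflections). The group $W$ acts on $X\times V$ by $g.(x,v)=(g.x,g.v)$. *)

(* Defs.v *)
From HB Require Import structures.
From mathcomp Require Import all_boot all_order all_algebra.
From mathcomp Require Import complex.
From mathcomp Require Import all_classical all_reals all_analysis.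

Set Implicit Arguments.
Unset Strict Implicit.
Unset Printing Implicit Defensive.

Import Order.TTheory GRing.Theory Num.Theory.
Import numFieldNormedType.Exports.
Local Open Scope classical_set_scope.
Local Open Scope quotient_scope.
Local Open Scope ring_scope.

(* Naming the structure (instead of using the bare type [R[i]]) is what makes
   the normed-module instances of ['rV[complexes R]_n] available; the topology
   is the one given by the modulus. [differentiable] is then complex Frechet
   differentiability. *)
Definition complexes (R : realType) : numClosedFieldType := R[i]%C.

Section ComplexManifolds.
Variable R : realType.
Local Notation C := (complexes R).

(* Only the values of [chart_fun] on [chart_dom] are meaningful. *)
Record chart (n : nat) (T : topologicalType) := Chart {
  chart_dom : set T ;
  chart_fun :> T -> 'rV[C]_n }.

(* [c] is a homeomorphism from an open set onto an open subset of C^n. *)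
Definition is_chart n (T : topologicalType) (c : chart n T) : Prop :=
  [/\ open (chart_dom c),
      {in chart_dom c &, injective c},
      {in chart_dom c, continuous c} &
      forall U : set T, open U -> U `<=` chart_dom c -> open (c @` U)].

(* The transition map d \o c^-1 is holomorphic on c(dom c `&` dom d); it is
   given by any function [g] such that d = g \o c on dom c `&` dom d. *)
Definition compatible n (T : topologicalType) (c d : chart n T) : Prop :=
  exists g : 'rV[C]_n -> 'rV[C]_n, forall x,
    chart_dom c x -> chart_dom d x -> d x = g (c x) /\ differentiable g (c x).

Record mfd := Mfd {
  mfd_space :> topologicalType ;
  mfd_dim : nat ;
  mfd_atlas : set (chart mfd_dim mfd_space) }.

Definition is_complex_mfd (M : mfd) : Prop :=
  [/\ hausdorff_space M, @second_countable M,
      forall c, mfd_atlas (m:=M) c -> is_chart c,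
      forall x : M, exists2 c, mfd_atlas (m:=M) c & chart_dom c x &
      forall c d, mfd_atlas (m:=M) c -> mfd_atlas (m:=M) d -> compatible c d].

(* Near [x], [f] reads as a holomorphic map [g] in some charts. *)
Definition holomorphic_at (M N : mfd) (f : M -> N) (x : M) : Prop :=
  exists (c : chart (mfd_dim M) M) (d : chart (mfd_dim N) N)
         (g : 'rV[C]_(mfd_dim M) -> 'rV[C]_(mfd_dim N)),
    [/\ mfd_atlas c, mfd_atlas d, chart_dom c x,
        \forall y \near x, chart_dom d (f y) /\ d (f y) = g (c y) &
        \forall z \near c x, differentiable g z].

Definition holomorphic (M N : mfd) (f : M -> N) : Prop :=
  forall x, holomorphic_at f x.

Definition coord_mfd (n : nat) : mfd :=
  @Mfd 'rV[C]_n n [set Chart setT id].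

(* The library puts no topology on a [vectType]; both the topology and the
   chart come from the coordinates in a basis. *)
Definition vect_mfd (V : vectType C) : mfd :=
  let coords := passmx.rVof (vbasis {:V}%VS) in
  @Mfd (initial_topology coords) (\dim {:V})
    [set @Chart _ (initial_topology coords) setT coords].

Definition sub_mfd (M : mfd) (A : set M) : mfd :=
  @Mfd (A : Type) (mfd_dim M)
    [set Chart (set_val @^-1` chart_dom c) (c \o set_val)
       | c in @mfd_atlas M].

Definition prod_mfd (M N : mfd) : mfd :=
  @Mfd (M * N)%type (mfd_dim M + mfd_dim N)%N
    [set Chart (chart_dom c `*` chart_dom d)
               (fun x => row_mx (c x.1) (d x.2))
       | c in @mfd_atlas M & d in @mfd_atlas N].

(* The charts of a quotient are the c \o (proj|U)^-1, for U an open set on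
   which the projection is injective. *)
Definition quot_mfd (M : mfd) (Q : quotType M) : mfd :=
  let proj : M -> quotient_topology Q := \pi_Q in
  @Mfd (quotient_topology Q) (mfd_dim M)
    [set c' | exists (c : chart (mfd_dim M) M) (U : set M),
      [/\ mfd_atlas c, open U, U `<=` chart_dom c, {in U &, injective proj} &
          chart_dom c' = proj @` U /\ forall x, U x -> c' (proj x) = c x]].

(* The operations only matter on pairs of points of a same fibre. *)
Record vbundle (B : mfd) := VBundle {
  vb_total :> mfd ;
  vb_proj : vb_total -> B ;
  vb_rank : nat ;
  vb_add : vb_total -> vb_total -> vb_total ;
  vb_scale : C -> vb_total -> vb_total }.

(* (proj, phi) is a biholomorphism from the part of E over U to U * C^r, with
   inverse psi, which is linear on the fibres. *)
Definition local_trivialization (B : mfd) (E : vbundle B) (U : set B)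
    (phi : E -> coord_mfd (vb_rank E))
    (psi : prod_mfd B (coord_mfd (vb_rank E)) -> E) : Prop :=
  [/\ forall e : E, U (vb_proj e) ->
        holomorphic_at phi e /\ psi (vb_proj e, phi e) = e,
      forall b z, U b ->
        [/\ holomorphic_at psi (b, z),
            vb_proj (psi (b, z)) = b & phi (psi (b, z)) = z],
      forall e e' : E, U (vb_proj e) -> vb_proj e = vb_proj e' ->
        phi (vb_add e e') = (phi e : 'rV[C]__) + phi e' &
      forall (a : C) (e : E), U (vb_proj e) ->
        phi (vb_scale a e) = a *: (phi e : 'rV[C]__)].

(* The vector space axioms in the fibres are not repeated: they are carried
   over from C^r by the local trivializations. *)
Definition is_holomorphic_vbundle (B : mfd) (E : vbundle B) : Prop :=
  [/\ is_complex_mfd B /\ is_complex_mfd E,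
      holomorphic (@vb_proj B E),
      forall e e' : E, vb_proj e = vb_proj e' ->
        vb_proj (vb_add e e') = vb_proj e,
      forall (a : C) (e : E), vb_proj (vb_scale a e) = vb_proj e &
      forall b : B, exists (U : set B) phi psi,
        [/\ open U, U b & @local_trivialization B E U phi psi]].

Definition holomorphically_equivalent (B : mfd) (E F : vbundle B) : Prop :=
  [/\ is_holomorphic_vbundle E, is_holomorphic_vbundle F &
    exists (f : E -> F) (g : F -> E),
      [/\ cancel f g /\ cancel g f,
          holomorphic f /\ holomorphic g,
          forall e : E, vb_proj (f e) = vb_proj e,
          forall e e' : E, vb_proj e = vb_proj e' ->
            f (vb_add e e') = vb_add (f e) (f e') &
          forall (a : C) (e : E), f (vb_scale a e) = vb_scale a (f e)]].

Definition trivial_vbundle (B : mfd) (V : vectType C) : vbundle B :=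
  @VBundle B (prod_mfd B (vect_mfd V)) fst (\dim {:V})
    (fun e e' => (e.1, (e.2 : V) + e'.2))
    (fun a e => (e.1, a *: (e.2 : V))).

End ComplexManifolds.

Section ReflectionGroups.
Variables (R : realType) (V : vectType (complexes R)).

Definition hyperplane (H : {vspace V}) : Prop := (\dim H).+1 = \dim {:V}.

(* The identity is excluded: it fixes every hyperplane, and counting it as a
   reflection would put all the hyperplanes in the arrangement. *)
Definition reflection (s : 'End(V)) : Prop :=
  [/\ exists2 k : nat, (0 < k)%N & forall v, iter k s v = v,
      s != \1%VF &
      exists2 H, hyperplane H & (H <= fixedSpace s)%VS].

Definition subgroup_GL (G : set 'End(V)) : Prop :=
  [/\ G \1%VF,
      forall f g, G f -> G g -> G (f \o g)%VF &
      forall f, G f -> exists2 g, G g & (f \o g)%VF = \1%VF /\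
                                        (g \o f)%VF = \1%VF].

Record reflection_group := ReflectionGroup {
  refl_set : set 'End(V) ;
  refl_subgroup : subgroup_GL refl_set ;
  refl_finite : finite_set refl_set ;
  refl_generated : exists2 S : set 'End(V),
    S `<=` reflection & refl_set = smallest subgroup_GL S }.

Variable W : reflection_group.

Definition arrangement : set {vspace V} :=
  [set H | hyperplane H /\
     exists s, [/\ refl_set W s, reflection s & (H <= fixedSpace s)%VS]].

Definition complement : set (vect_mfd V) :=
  ~` \bigcup_(H in arrangement) [set v : V | v \in H].

Definition complement_mfd : mfd R := sub_mfd complement.

Definition orbit_rel (x y : complement_mfd) : bool :=
  `[< exists2 w, refl_set W w & w (set_val x) = set_val y >].

Lemma orbit_rel_equiv : equiv_class_of orbit_rel.
Proof.
have [W1 WM WV] := refl_subgroup W.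
split=> [x|x y|y x z].
- by apply/asboolP; exists \1%VF => //; rewrite lfunE.
- apply/asboolP/asboolP => -[w Ww wxy]; have [w' Ww' [_ w'K]] := WV _ Ww;
    by exists w' => //; rewrite -wxy -comp_lfunE w'K lfunE.
- move=> /asboolP[w Ww wxy] /asboolP[w' Ww' wyz]; apply/asboolP.
  by exists (w' \o w)%VF; [exact: WM | rewrite comp_lfunE wxy].
Qed.

Canonical orbit_equiv := EquivRelPack orbit_rel_equiv.

Definition orbit_mfd : mfd R :=
  quot_mfd ({eq_quot orbit_equiv} : quotType complement_mfd).

Local Notation XV := (prod_mfd complement_mfd (vect_mfd V)).

Definition diag_orbit_rel (p q : XV) : bool :=
  `[< exists2 w, refl_set W w & w (set_val p.1) = set_val q.1 /\ w p.2 = q.2 >].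

Lemma diag_orbit_rel_equiv : equiv_class_of diag_orbit_rel.
Proof.
have [W1 WM WV] := refl_subgroup W.
split=> [p|p q|q p r].
- by apply/asboolP; exists \1%VF => //; rewrite !lfunE.
- apply/asboolP/asboolP => -[w Ww [w1 w2]]; have [w' Ww' [_ w'K]] := WV _ Ww;
    by exists w' => //; rewrite -w1 -w2 -!comp_lfunE w'K !lfunE.
- move=> /asboolP[w Ww [w1 w2]] /asboolP[w' Ww' [w1' w2']]; apply/asboolP.
  exists (w' \o w)%VF; first exact: WM.
  by rewrite !comp_lfunE w1 w2.
Qed.

Canonical diag_orbit_equiv := EquivRelPack diag_orbit_rel_equiv.

Definition diag_orbit_mfd : mfd R :=
  quot_mfd ({eq_quot diag_orbit_equiv} : quotType XV).

Definition orbit_class (x : complement_mfd) : orbit_mfd :=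
  \pi_({eq_quot orbit_equiv}) x.

Definition diag_orbit_class (p : XV) : diag_orbit_mfd :=
  \pi_({eq_quot diag_orbit_equiv}) p.

(* Fibre operations: a * [x, v] = [x, a * v] and [x, v] + [x, u] = [x, v + u]. *)
Definition quotient_vbundle : vbundle orbit_mfd :=
  @VBundle R orbit_mfd diag_orbit_mfd
    (fun e => orbit_class (repr e).1)
    (\dim {:V})
    (fun e e' => let: (x, v) := repr e in
       diag_orbit_class
         (x, (v : V) + xget (0 : V) [set u | diag_orbit_class (x, u) = e']))
    (fun a e => let: (x, v) := repr e in diag_orbit_class (x, a *: (v : V))).

End ReflectionGroups.

(* Main.v *)
Require Import Defs.
From HB Require Import structures.
From mathcomp Require Import all_boot all_order all_algebra.
From mathcomp Require Import complex zify ring.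
From mathcomp Require Import all_classical all_reals all_analysis.

Set Implicit Arguments.
Unset Strict Implicit.
Unset Printing Implicit Defensive.

Import Order.TTheory GRing.Theory Num.Theory.
Import numFieldNormedType.Exports.
Local Open Scope classical_set_scope.
Local Open Scope quotient_scope.
Local Open Scope ring_scope.

(** Let [X] be the complement of the mirrors.  A trivialization of the quotient
    bundle amounts to maps [theta_1, ..., theta_n : V -> V], where [n] is the
    dimension of [V], that are equivariant ([theta_i (w x) = w (theta_i x)]) and
    form a basis of [V] at every point of [X]: the coordinates of [v] in the
    basis [theta_i x] depend only on the orbit of [(x, v)], and are holomorphic
    in [(x, v)].  The maps found here are homogeneous polynomial maps.

    The polynomial equivariant maps form a graded module over the invariants.
    Take homogeneous elements [theta_i] that are linearly independent modulo the
    multiples of equivariant maps by invariants of positive degree.  Chevalley's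
    lemma ([chevalley_relation]), which rests on divided differences by
    reflections, shows that they satisfy no linear relation with invariant
    coefficients ([minimal_family_invariant_free]); averaging over the group
    excludes relations with arbitrary polynomial coefficients as well
    ([minimal_family_free]).  Hence there are at most [n] of them, a maximal
    family exists, and by a graded form of Nakayama's lemma it generates the
    module ([generating_family_exists]).

    At a point with trivial stabilizer, interpolation yields equivariant maps
    with any prescribed value ([equivariant_interpolation]), so the [theta_i]
    span [V] there; in particular there are exactly [n] of them, and their
    determinant [J] vanishes at most on the union of the spaces [V^w] fixed by
    the elements [w <> 1].  The zero set of a homogeneous polynomial has pure
    codimension one, so the [V^w] of codimension one, which are the mirrors,
    already contain all zeros of [J] ([hpoly_zeros_on_hyperplanes],
    [equivariant_frame_exists]).

    Thus [X] is the set where [J] does not vanish ([complementP]).  As an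
    element fixing [x] fixes all the [theta_i x], the group acts freely on [X],
    which is Steinberg's theorem here; so [X / W] and [(X * V) / W] are
    manifolds whose charts are local inverses of the projections
    ([quot_complex_mfd]), and holomorphy of the trivialization can be checked on
    [X * V] ([holomorphic_lift]), where it is a matter of polynomials and of the
    inverse of a matrix. *)

(** * Homogeneous polynomial functions *)

Section PolynomialFunctions.
Variables (K : numClosedFieldType) (V : vectType K).
Implicit Types (p q l : V -> K) (d e : nat).

Definition linear_form l := forall a u v, l (a *: u + v) = a * l u + l v.

Lemma linear_form0 l : linear_form l -> l 0 = 0.
Proof. by move=> ll; have := ll (-1) 0 0; rewrite scaler0 addr0 mulN1r addNr. Qed.

Lemma linear_formD l u v : linear_form l -> l (u + v) = l u + l v.
Proof. by move=> ll; have := ll 1 u v; rewrite scale1r mul1r. Qed.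

Lemma linear_formZ l a u : linear_form l -> l (a *: u) = a * l u.
Proof. by move=> ll; have := ll a u 0; rewrite (linear_form0 ll) !addr0. Qed.

Lemma linear_form_sum l I (r : seq I) (P : pred I) (F : I -> V) :
  linear_form l -> l (\sum_(i <- r | P i) F i) = \sum_(i <- r | P i) l (F i).
Proof.
move=> ll; elim/big_ind2: _ => //; first exact: linear_form0.
by move=> x1 x2 y1 y2 <- <-; rewrite linear_formD.
Qed.

Lemma linear_form_comp l (f : 'End(V)) :
  linear_form l -> linear_form (fun x => l (f x)).
Proof. by move=> ll a u v; rewrite linearP ll. Qed.

Definition coord_form i (v : V) : K := coord (vbasis {:V}) i v.

Lemma coord_form_linear i : linear_form (coord_form i).
Proof. by move=> a u v; rewrite /coord_form linearP. Qed.

Lemma coord_form_expand v : v = \sum_i coord_form i v *: (vbasis {:V})`_i.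
Proof. by rewrite {1}(coord_vbasis (memvf v)). Qed.

(** Homogeneous polynomials are taken as functions and built from linear forms,
    which makes them independent of a basis and stable under composition with
    linear maps. *)
Inductive hpoly : nat -> (V -> K) -> Prop :=
| hpoly_const c : hpoly 0 (fun=> c)
| hpolyD d p q : hpoly d p -> hpoly d q -> hpoly d (fun x => p x + q x)
| hpoly_formM d l p :
    linear_form l -> hpoly d p -> hpoly d.+1 (fun x => l x * p x).

Lemma hpoly_ext d p q : p =1 q -> hpoly d p -> hpoly d q.
Proof. by move=> /funext ->. Qed.

Lemma hpoly0 d : hpoly d (fun=> 0).
Proof.
elim: d => [|d IHd]; first exact: hpoly_const.
have l0 : linear_form (fun=> 0) by move=> a u v; rewrite mulr0 addr0.
by apply: hpoly_ext (hpoly_formM l0 IHd) => x; rewrite mul0r.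
Qed.

Lemma hpolyM d e p q :
  hpoly d p -> hpoly e q -> hpoly (d + e) (fun x => p x * q x).
Proof.
move=> Pp Pq; elim: Pp => {d p} [c|d p p' _ IHp _ IHp'|d l p ll _ IHp].
- elim: Pq => {e q} [c'|d p q _ IHp _ IHq|d l p ll _ IHp].
  + exact: hpoly_const.
  + by apply: hpoly_ext (hpolyD IHp IHq) => x; rewrite mulrDr.
  + by apply: hpoly_ext (hpoly_formM ll IHp) => x; rewrite mulrCA.
- by apply: hpoly_ext (hpolyD IHp IHp') => x; rewrite mulrDl.
- by apply: hpoly_ext (hpoly_formM ll IHp) => x; rewrite mulrA.
Qed.

Lemma hpolyZ d c p : hpoly d p -> hpoly d (fun x => c * p x).
Proof. exact: (hpolyM (hpoly_const c)). Qed.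

Lemma hpolyB d p q : hpoly d p -> hpoly d q -> hpoly d (fun x => p x - q x).
Proof.
move=> Pp Pq; apply: hpoly_ext (hpolyD Pp (hpolyZ (-1) Pq)) => x.
by rewrite mulN1r.
Qed.

Lemma hpoly_form l : linear_form l -> hpoly 1 l.
Proof.
move=> ll; apply: hpoly_ext (hpoly_formM ll (hpoly_const 1)) => x.
by rewrite mulr1.
Qed.

Lemma hpoly_sum d I (r : seq I) (P : pred I) (F : I -> V -> K) :
  (forall i, P i -> hpoly d (F i)) ->
  hpoly d (fun x => \sum_(i <- r | P i) F i x).
Proof.
move=> PF; elim: r => [|i r IHr].
  by apply: hpoly_ext (hpoly0 d) => x; rewrite big_nil.
case Pi: (P i).
  by apply: hpoly_ext (hpolyD (PF i Pi) IHr) => x; rewrite big_cons Pi.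
by apply: hpoly_ext IHr => x; rewrite big_cons Pi.
Qed.

Lemma hpoly_prod I (r : seq I) (D : I -> nat) (F : I -> V -> K) :
  (forall i, hpoly (D i) (F i)) ->
  hpoly (\sum_(i <- r) D i) (fun x => \prod_(i <- r) F i x).
Proof.
move=> PF; elim: r => [|i r IHr].
  by rewrite big_nil; apply: hpoly_ext (hpoly_const 1) => x; rewrite big_nil.
by rewrite big_cons; apply: hpoly_ext (hpolyM (PF i) IHr) => x; rewrite big_cons.
Qed.

Lemma hpoly_comp d p (f : 'End(V)) : hpoly d p -> hpoly d (fun x => p (f x)).
Proof.
elim=> {d p} [c|d p q _ IHp _ IHq|d l p ll _ IHp].
- exact: hpoly_const.
- exact: hpolyD IHp IHq.
- exact: hpoly_formM (linear_form_comp f ll) IHp.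
Qed.

Lemma hpoly_constant d p : hpoly d p -> d = 0%N -> forall x, p x = p 0.
Proof. by elim=> {d p} // d p q _ IHp _ IHq d0 x; rewrite IHp // IHq. Qed.

(** Restricted to a line, a homogeneous polynomial becomes a univariate one,
    whose top coefficient is its value at the direction of the line. *)
Lemma hpoly_line d p y u : hpoly d p ->
  exists P : {poly K},
    [/\ (size P <= d.+1)%N, P`_d = p u & forall t, P.[t] = p (y + t *: u)].
Proof.
elim=> {d p} [c|d p q _ [P [sP cP eP]] _ [Q [sQ cQ eQ]]|d l p ll _ [P [sP cP eP]]].
- by exists c%:P; split=> [||t]; rewrite ?size_polyC_leq1 ?coefC ?hornerC.
- exists (P + Q); split=> [||t]; rewrite ?coefD ?hornerD ?cP ?cQ ?eP ?eQ //.
  by rewrite (leq_trans (size_polyD _ _)) // geq_max sP.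
- exists ((l u *: 'X + (l y)%:P) * P); split=> [||t].
  + rewrite (leq_trans (size_polyMleq _ _)) //.
    have s2 : (size (l u *: 'X + (l y)%:P)%R <= 2)%N.
      rewrite (leq_trans (size_polyD _ _)) // geq_max.
      rewrite (leq_trans (size_scale_leq _ _)) ?size_polyX //=.
      by rewrite (leq_trans (size_polyC_leq1 _)).
    by move: s2 sP; lia.
  + rewrite mulrDl coefD -scalerAl coefZ coefXM /= cP mul_polyC coefZ.
    by rewrite [P`_d.+1]nth_default // mulr0 addr0.
  + rewrite hornerM eP !hornerE (linear_formD _ _ ll) (linear_formZ _ _ ll).
    by rewrite addrC [t * _]mulrC.
Qed.

(** Polynomial functions form an integral domain: on the line joining two points
    where the factors do not vanish, both are nonzero univariate polynomials. *)
Lemma hpoly_mul_neq0 d e p q : hpoly d p -> hpoly e q ->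
  (exists x, p x != 0) -> (exists x, q x != 0) -> exists x, p x * q x != 0.
Proof.
move=> Pp Pq [x px] [y qy].
have [P [_ _ eP]] := hpoly_line x (y - x) Pp.
have [Q [_ _ eQ]] := hpoly_line x (y - x) Pq.
have P0 : P != 0.
  apply: contraNneq px => P0; have := eP 0.
  by rewrite P0 horner0 scale0r addr0 => <-.
have Q0 : Q != 0.
  apply: contraNneq qy => Q0; have := eQ 1.
  by rewrite Q0 horner0 scale1r addrC subrK => <-.
have /closed_nonrootP[t] : P * Q != 0 by rewrite mulf_neq0.
by rewrite rootE hornerM eP eQ => ?; exists (x + t *: (y - x)).
Qed.

Lemma hpoly_prod_neq0 I (r : seq I) (F : I -> V -> K) :
  (forall i, exists d, hpoly d (F i)) -> (forall i, exists x, F i x != 0) ->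
  exists x, \prod_(i <- r) F i x != 0.
Proof.
move=> /choice[D PF] nzF; elim: r => [|i r IHr].
  by exists 0; rewrite big_nil oner_neq0.
have [x xP] := hpoly_mul_neq0 (PF i) (hpoly_prod r PF) (nzF i) IHr.
by exists x; rewrite big_cons.
Qed.

Lemma subspace_form (U : {vspace V}) : (\dim U < \dim {:V})%N ->
  exists m : V -> K,
    [/\ linear_form m, (exists y, m y != 0) & forall v, v \in U -> m v = 0].
Proof.
move=> dimU; have /subvPn[v _ vU] : ~~ ({:V} <= U)%VS.
  by apply: contraTN dimU => /dimvS; rewrite leqNgt.
pose w := v - projv U v.
have w0 : w != 0.
  by apply: contraNneq vU => /eqP; rewrite subr_eq0 => /eqP ->; exact: memv_proj.
have [i wi] : exists i, coord_form i w != 0.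
  apply: contrapT => /forallNP w_i; move/eqP: w0; apply.
  rewrite (coord_form_expand w) big1 // => i _.
  by have /negP/negPn/eqP -> := w_i i; rewrite scale0r.
exists (fun x => coord_form i (x - projv U x)); split.
- by move=> a x y; rewrite linearP opprD addrACA -scalerBr coord_form_linear.
- by exists v.
- by move=> x xU; rewrite projv_id // subrr /coord_form linear0.
Qed.

(** The zero set of a homogeneous polynomial is a hypersurface: if it lies in
    the union of some hyperplanes and some subspaces of codimension at least
    two, the latter contribute nothing.  Along a generic direction [u] the
    roots of [p (y + t u)] are all met on the hyperplanes when [y] is generic,
    so [p y] is one of finitely many products of the linear forms; being equal
    generically, [p] is one of these products. *)
Lemma hpoly_zeros_on_hyperplanes d p (I J : finType) (l : I -> V -> K)
    (L : J -> {vspace V}) x :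
  hpoly d p -> (forall i, linear_form (l i)) ->
  (forall i, exists y, l i y != 0) ->
  (forall j, (\dim (L j)).+1 < \dim {:V})%N ->
  (forall y, p y = 0 -> (exists i, l i y = 0) \/ (exists j, y \in L j)) ->
  (forall i, l i x != 0) -> p x != 0.
Proof.
move=> Pp ll nzl dimL zp lx.
have codim2 (u : V) : exists m : J -> V -> K, forall j,
    [/\ linear_form (m j), (exists y, m j y != 0) &
        forall v, v \in (L j + <[u]>)%VS -> m j v = 0].
  suff /choice[m mP] : forall j, exists m : V -> K,
      [/\ linear_form m, (exists y, m y != 0) &
          forall v, v \in (L j + <[u]>)%VS -> m v = 0] by exists m.
  move=> j.
  apply: subspace_form; apply: leq_ltn_trans (dimL j).
  rewrite (leq_trans (dimv_add_leqif _ _).1) // -addn1 leq_add2l.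
  by rewrite dim_vline leq_b1.
have hl i : exists d, hpoly d (l i) by exists 1%N; exact: hpoly_form.
have nzp : exists y, p y != 0.
  apply: contrapT => /forallNP p0.
  have [m mP] := codim2 0.
  have hm j : exists d, hpoly d (m j).
    by exists 1%N; apply: hpoly_form; have [] := mP j.
  have nzm j : exists y, m j y != 0 by have [] := mP j.
  have [y] := @hpoly_prod_neq0 _ (index_enum (I + J)%type)
    (fun k => match k with inl i => l i | inr j => m j end)
    ltac:(by case) ltac:(by case).
  rewrite prodf_seq_neq0 => /allP yP.
  have /zp[[i iy]|[j jy]] : p y = 0 by have /negP/negPn/eqP := p0 y.
    by have := yP (inl i) (mem_index_enum _); rewrite /= iy eqxx.
  have := yP (inr j) (mem_index_enum _); rewrite /=; have [_ _ ->] := mP j.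
    by rewrite eqxx.
  by rewrite -[y]addr0; apply: memv_add => //; rewrite mem0v.
have [u] := hpoly_mul_neq0 Pp (hpoly_prod (index_enum I) (fun i => hpoly_form (ll i)))
  nzp (hpoly_prod_neq0 (index_enum I) hl nzl).
rewrite mulf_eq0 negb_or prodf_seq_neq0 => /andP[pu /allP lu].
have {}lu i : l i u != 0 by exact: lu (mem_index_enum _).
have [m mP] := codim2 u.
(* The candidates for [p]: products of [d] of the forms, normalized at [u]. *)
pose q (s : d.-tuple I) v := p u * \prod_(i <- s) (l i v / l i u).
have Pq s : hpoly d (q s).
  have sum_d : \sum_(i <- s) 1%N = d.
    by rewrite sum1_size size_tuple.
  apply: hpolyZ; rewrite -[X in hpoly X]sum_d; apply: hpoly_prod => i.
  apply: hpoly_ext (hpolyZ (l i u)^-1 (hpoly_form (ll i))).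
  by move=> v; rewrite mulrC.
(* When [m j y != 0], the line [y + t u] misses [L j], so that each of the [d]
   roots [z] of [p] on it satisfies [- z = l i y / l i u] for some [i]. *)
have generic y : (forall j, m j y != 0) -> exists s, p y = q s y.
  move=> my; have [P [sP cP eP]] := hpoly_line y u Pp.
  have sizeP : size P = d.+1.
    apply/eqP; rewrite eqn_leq sP ltnNge; apply: contra pu => le_d.
    by rewrite -cP nth_default.
  have [r rP] := closed_field_poly_normal P.
  have leadP : lead_coef P = p u by rewrite lead_coefE sizeP.
  have size_r : size r = d.
    move: sizeP; rewrite rP size_scale ?leadP // size_prod_XsubC.
    by move=> [].
  have /choice[k kP] : forall z, exists k : option I, z \in r ->
      if k is Some i then - z = l i y / l i u else False.
    move=> z.
    case: (boolP (z \in r)) => [zr|_]; last by exists None.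
    have /zp[[i iz]|[j jz]] : p (y + z *: u) = 0.
    - rewrite -eP rP hornerZ horner_prod (big_rem z) //= hornerXsubC subrr.
      by rewrite mul0r mulr0.
    - exists (Some i) => _; move: iz.
      rewrite (linear_formD _ _ (ll i)) (linear_formZ _ _ (ll i)) => /eqP.
      by rewrite addr_eq0 => /eqP ->; rewrite mulNr mulfK.
    - have := my j; have [_ _ ->] := mP j; first by rewrite eqxx.
      rewrite -(addrK (z *: u) y); apply: memv_add => //.
      by rewrite memvN memvZ ?memv_line.
  have [s sk] : exists s : seq I, map k r = map Some s.
    elim: r {rP size_r} kP => [|z r IHr] kP; first by exists [::].
    have [|s rs] := IHr; first by move=> z' z'r; apply: kP; rewrite inE z'r orbT.
    have := kP z (mem_head _ _); case ekz : (k z) => [i|] // _.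
    by exists (i :: s); rewrite /= ekz rs.
  have size_s : size s == d by rewrite -size_r -(size_map k) sk size_map.
  exists (Tuple size_s); rewrite -[y in LHS]addr0 -(scale0r u) -eP rP leadP.
  rewrite hornerZ horner_prod /q /=; congr (_ * _).
  have {}kP z : z \in r -> - z = if k z is Some i then l i y / l i u else 0.
    by move=> /kP; case: (k z).
  rewrite (eq_big_seq (fun z => if k z is Some i then l i y / l i u else 0)).
    rewrite -(big_map k predT (fun o => if o is Some i then l i y / l i u else 0)).
    by rewrite sk big_map.
  by move=> z zr /=; rewrite hornerXsubC sub0r kP.
(* Otherwise the nonzero polynomials [p - q s] and [m j] would all be nonzero at
   some point, against [generic]. *)
suff [s ps] : exists s, p =1 q s.
  rewrite ps mulf_neq0 // prodf_seq_neq0; apply/allP => i _ /=.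
  by rewrite mulf_neq0 ?invr_eq0.
apply: contrapT => /forallNP np.
have [y] := @hpoly_prod_neq0 _ (index_enum (d.-tuple I + J)%type)
    (fun k v => match k with inl s => p v - q s v | inr j => m j v end)
    ltac:(case=> [s|j]; [by exists d; exact: hpolyB
                        |by exists 1%N; apply: hpoly_form; have [] := mP j])
    ltac:(case=> [s|j]; [|by have [] := mP j]; apply: contrapT => /forallNP ns;
          apply: (np s) => v; apply/eqP; rewrite -subr_eq0;
          by have /negP/negPn := ns v).
rewrite prodf_seq_neq0 => /allP yP.
have [|s sy] := generic y; first by move=> j; exact: yP (inr j) (mem_index_enum _).
by have := yP (inl s) (mem_index_enum _); rewrite /= sy subrr eqxx.
Qed.

End PolynomialFunctions.

(** * Invariants and Chevalley's lemma *)

Section FiniteLinearGroups.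
Variables (K : numClosedFieldType) (V : vectType K) (W : seq 'End(V)).
Implicit Types (p q r s l : V -> K) (psi theta : V -> V) (d e k : nat).

Definition finite_linear_group : Prop :=
  [/\ uniq W, \1%VF \in W,
      {in W &, forall f g, (f \o g)%VF \in W} &
      {in W, forall f, exists2 g, g \in W &
         (f \o g)%VF = \1%VF /\ (g \o f)%VF = \1%VF}].

Hypothesis groupW : finite_linear_group.

Let W_uniq : uniq W. Proof. by case: groupW. Qed.
Let W1 : \1%VF \in W. Proof. by case: groupW. Qed.
Let WM : {in W &, forall f g, (f \o g)%VF \in W}. Proof. by case: groupW. Qed.

Lemma group_inv w : w \in W ->
  [/\ (w^-1)%VF \in W, cancel w (w^-1)%VF & cancel (w^-1)%VF w].
Proof.
move=> Ww; have [_ _ _ /(_ w Ww)[g Wg [wg gw]]] := groupW.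
have kw : lker w == 0%VS.
  apply/lker0P => x y wxy; rewrite -[x](id_lfunE) -[y](id_lfunE) -gw.
  by rewrite !comp_lfunE wxy.
have wK := lker0_lfunK kw; have wKV : cancel (w^-1)%VF w.
  by move=> x; rewrite -[x](id_lfunE) -wg comp_lfunE wK.
split=> //; suff -> : (w^-1)%VF = g by [].
by apply/lfunP => x; rewrite -[LHS](id_lfunE) -gw comp_lfunE wKV.
Qed.

Lemma group_inj w : w \in W -> injective w.
Proof. by move=> /group_inv[_ /can_inj]. Qed.

Lemma group_map_perm (F : 'End(V) -> 'End(V)) :
  {in W, forall w, F w \in W} -> {in W &, injective F} ->
  perm_eq [seq F w | w <- W] W.
Proof.
move=> FW Finj; have uF : uniq [seq F w | w <- W] by rewrite map_inj_in_uniq.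
have sub : {subset [seq F w | w <- W] <= W} by move=> _ /mapP[w /FW ? ->].
apply: uniq_perm => //.
by have [] := uniq_min_size uF sub ltac:(by rewrite size_map).
Qed.

Lemma group_mulr_perm h : h \in W -> perm_eq [seq (w \o h)%VF | w <- W] W.
Proof.
move=> Wh; have [_ _ hK] := group_inv Wh.
apply: group_map_perm => [w Ww|w w' _ _ /lfunP eq_wh]; first exact: WM.
by apply/lfunP => x; have := eq_wh (h^-1%VF x); rewrite !comp_lfunE hK.
Qed.

Definition invariant p := {in W, forall w : 'End(V), forall x, p (w x) = p x}.

Definition invp d p := hpoly d p /\ invariant p.

Lemma invpM d e p q : invp d p -> invp e q -> invp (d + e) (fun x => p x * q x).
Proof.
by move=> [Pp Ip] [Pq Iq]; split=> [|w Ww x]; [exact: hpolyM|rewrite Ip ?Iq].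
Qed.

Lemma invp_const c : invp 0 (fun=> c).
Proof. by split=> //; exact: hpoly_const. Qed.

Lemma invpZ d c p : invp d p -> invp d (fun x => c * p x).
Proof. exact: (invpM (invp_const c)). Qed.

Definition reynolds p x := (size W)%:R^-1 * \sum_(w <- W) p (w x).

Lemma size_group_neq0 : (size W)%:R != 0 :> K.
Proof. by rewrite pnatr_eq0; case: (W) W1. Qed.

Lemma invp_sum d p : hpoly d p -> invp d (fun x => \sum_(w <- W) p (w x)).
Proof.
move=> Pp; split=> [|h Wh x]; first by apply: hpoly_sum => w _; exact: hpoly_comp.
rewrite -[in RHS](perm_big _ (group_mulr_perm Wh)) big_map.
by apply: eq_bigr => w _; rewrite comp_lfunE.
Qed.

Lemma invp_reynolds d p : hpoly d p -> invp d (reynolds p).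
Proof. by move=> /invp_sum; exact: invpZ. Qed.

(** The homogeneous ideal generated by the invariants of positive degree. *)
Inductive coinv_ideal : nat -> (V -> K) -> Prop :=
| coinv_ideal0 d : coinv_ideal d (fun=> 0)
| coinv_idealD d p q : coinv_ideal d p -> coinv_ideal d q ->
    coinv_ideal d (fun x => p x + q x)
| coinv_idealM d e k s r : invp e s -> (0 < e)%N -> hpoly k r -> d = (e + k)%N ->
    coinv_ideal d (fun x => s x * r x).

Lemma coinv_ideal_ext d p q : p =1 q -> coinv_ideal d p -> coinv_ideal d q.
Proof. by move=> /funext ->. Qed.

Lemma coinv_idealZ d c p :
  coinv_ideal d p -> coinv_ideal d (fun x => c * p x).
Proof.
elim=> {d p} [d|d p q _ IHp _ IHq|d e k s r Ss e0 Pr dE].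
- by apply: coinv_ideal_ext (coinv_ideal0 d) => x; rewrite mulr0.
- by apply: coinv_ideal_ext (coinv_idealD IHp IHq) => x; rewrite mulrDr.
- apply: coinv_ideal_ext (coinv_idealM Ss e0 (hpolyZ c Pr) dE) => x.
  by rewrite mulrCA.
Qed.

Lemma coinv_ideal_comp d p w : w \in W ->
  coinv_ideal d p -> coinv_ideal d (fun x => p (w x)).
Proof.
move=> Ww; elim=> {d p} [d|d p q _ IHp _ IHq|d e k s r Ss e0 Pr dE].
- exact: coinv_ideal0.
- exact: coinv_idealD IHp IHq.
- apply: coinv_ideal_ext (coinv_idealM Ss e0 (hpoly_comp w Pr) dE) => x.
  by have [_ ->] := Ss.
Qed.

Definition reflection_by (l : V -> K) (a : V) (f : 'End(V)) :=
  [/\ linear_form l, exists y, l y != 0 & forall x, f x = x + l x *: a].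

(** [p \o f - p] vanishes on the mirror of [f], hence is divisible by the form
    [l]; the quotient is computed by a twisted Leibniz rule. *)
Lemma divided_difference d p l a (f : 'End(V)) :
  reflection_by l a f -> hpoly d p ->
  exists q, [/\ hpoly d.-1 q, d = 0%N -> forall x, q x = 0 &
                forall x, p (f x) - p x = l x * q x].
Proof.
move=> [ll _ fE]; elim=> {d p} [c|d p p' _ [q [Pq q0 qE]] _ [q' [Pq' q'0 q'E]]
  |d m p lm Pp [q [Pq q0 qE]]].
- by exists (fun=> 0); split=> // [|x]; [exact: hpoly0|rewrite subrr mulr0].
- exists (fun x => q x + q' x); split=> [|d0 x|x]; first exact: hpolyD.
    by rewrite q0 // q'0 // addr0.
  by rewrite mulrDr -qE -q'E; ring.
- exists (fun x => m x * q x + m a * p (f x)); split=> // [|x].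
    apply: hpolyD; last by apply: hpolyZ; exact: hpoly_comp.
    case: d Pp Pq q0 {qE} => [|d] Pp Pq q0 /=; last exact: hpoly_formM.
    by apply: hpoly_ext (hpoly0 _ _) => x; rewrite q0 // mulr0.
  rewrite {1}fE (linear_formD _ _ lm) (linear_formZ _ _ lm).
  rewrite mulrDr [l x * (m x * _)]mulrCA -qE; ring.
Qed.

(** Membership in [P] in degree [D - e], a negative degree forcing zero. *)
Definition shifted (P : nat -> (V -> K) -> Prop) D e r :=
  (forall x, r x = 0) \/ exists2 k, (k + e)%N = D & P k r.

(** Generation by reflections, as the induction principle it provides. *)
Definition reflection_generated : Prop :=
  forall G : 'End(V) -> Prop, G \1%VF ->
    {in W &, forall f g, G f -> G g -> G (f \o g)%VF} ->
    {in W, forall f, G f -> G (f^-1)%VF} ->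
    {in W, forall f : 'End(V), forall l a, reflection_by l a f -> G f} ->
    {in W, forall w, G w}.

Hypothesis refl_gen : reflection_generated.

(** If the divided differences of [p] lie in the ideal, then [p] is congruent
    to its transforms by the reflections, hence to its average over the group,
    which is an invariant of positive degree. *)
Lemma coinv_ideal_of_differences d p : hpoly d.+1 p ->
  {in W, forall f : 'End(V), forall l a, reflection_by l a f ->
     exists2 q, coinv_ideal d q & forall x, p (f x) - p x = l x * q x} ->
  coinv_ideal d.+1 p.
Proof.
move=> Pp Dp; have diff :
    {in W, forall w : 'End(V), coinv_ideal d.+1 (fun x => p (w x) - p x)}.
  apply: refl_gen => [|f g Wf Wg If Ig|f Wf If|f Wf l a fR].
  - by apply: coinv_ideal_ext (coinv_ideal0 _) => x; rewrite id_lfunE subrr.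
  - apply: coinv_ideal_ext (coinv_idealD (coinv_ideal_comp Wg If) Ig) => x.
    by rewrite comp_lfunE addrA subrK.
  - have [Wf' _ fK] := group_inv Wf.
    apply: coinv_ideal_ext (coinv_idealZ (-1) (coinv_ideal_comp Wf' If)) => x.
    by rewrite fK mulN1r opprB.
  - have [q Iq qE] := Dp _ Wf _ _ fR; have [ll _ _] := fR.
    suff : coinv_ideal d.+1 (fun x => l x * q x).
      by apply: coinv_ideal_ext => x; rewrite qE.
    elim: Iq {qE} => {q} [k|k q q' _ IHq _ IHq'|k e j s r Ss e0 Pr ->].
    + by apply: coinv_ideal_ext (coinv_ideal0 _) => x; rewrite mulr0.
    + by apply: coinv_ideal_ext (coinv_idealD IHq IHq') => x; rewrite mulrDr.
    + apply: coinv_ideal_ext (coinv_idealM Ss e0 (hpoly_formM ll Pr) _) => [x|].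
        by rewrite mulrCA.
      by rewrite addnS.
have Ir : coinv_ideal d.+1 (reynolds p).
  apply: coinv_ideal_ext
    (coinv_idealM (invp_reynolds Pp) (ltn0Sn _) (hpoly_const _ 1) _).
    by move=> x; rewrite mulr1.
  by rewrite addn0.
have Is : coinv_ideal d.+1 (fun x => \sum_(w <- W) (p (w x) - p x)).
  elim: (W) diff => [|w ws IHw] diff.
    by apply: coinv_ideal_ext (coinv_ideal0 _) => x; rewrite big_nil.
  apply: coinv_ideal_ext (coinv_idealD (diff w (mem_head _ _)) (IHw _)) => [x|].
    by rewrite big_cons.
  by move=> w' w'ws; apply: diff; rewrite inE w'ws orbT.
apply: coinv_ideal_ext (coinv_idealD Ir (coinv_idealZ (- (size W)%:R^-1) Is)) => x.
rewrite sumrB /reynolds mulNr mulrBr opprB addrC subrK.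
rewrite big_const_seq count_predT iter_addr_0 -[p x *+ _]mulr_natl.
by rewrite mulKf // size_group_neq0.
Qed.

(** Chevalley's lemma.  Taking differences under a reflection and dividing by its
    form turns the relation into one with the same coefficients [h] where the
    degree of [r m] has dropped, so by induction the divided differences of
    [r m] lie in the ideal.  In degree [0], a nonzero [r m] would let the
    averaged relation express [h m] through the other coefficients. *)
Lemma chevalley_relation d m (e : nat -> nat) (h r : nat -> V -> K) :
  (forall i, (i <= m)%N -> invp (e i) (h i)) ->
  (forall i, (i < m)%N -> shifted (@hpoly K V) (d + e m) (e i) (r i)) ->
  hpoly d (r m) -> (forall x, \sum_(i < m.+1) h i x * r i x = 0) ->
  ~ (exists b : nat -> V -> K,
      (forall i, (i < m)%N -> shifted invp (e m) (e i) (b i)) /\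
      forall x, h m x = \sum_(i < m) b i x * h i x) ->
  coinv_ideal d (r m).
Proof.
move=> Sh; elim: d r => [|d IHd] r Pr Prm rel hm.
  have r_const := hpoly_constant Prm (erefl _).
  have [c0|c_neq0] := eqVneq (r m 0) 0.
    by apply: coinv_ideal_ext (coinv_ideal0 _) => x; rewrite r_const c0.
  case: hm; exists (fun i x => - (r m 0)^-1 * reynolds (r i) x); split=> [i im|x].
    have [r0|[k kE Pri]] := Pr i im.
      by left=> x; rewrite /reynolds big1 ?mulr0 // => w _; rewrite r0.
    by right; exists k => //; apply: invpZ; exact: invp_reynolds.
  have : \sum_(w <- W) \sum_(i < m.+1) h i (w x) * r i (w x) = 0.
    by rewrite big1.
  rewrite exchange_big big_ord_recr /= => /eqP; rewrite addr_eq0.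
  have hS i : (i <= m)%N -> \sum_(w <- W) h i (w x) * r i (w x) =
      h i x * \sum_(w <- W) r i (w x).
    move=> im; rewrite big_distrr /=; apply: eq_big_seq => w Ww.
    by have [_ ->] := Sh i im.
  rewrite hS // => /eqP hrE.
  have hm_eq : h m x = - ((size W)%:R^-1 * (r m 0)^-1) *
      \sum_(i < m) \sum_(w <- W) h i (w x) * r i (w x).
    rewrite hrE [X in h m x * X](eq_bigr (fun=> r m 0)); last first.
      by move=> w _; rewrite r_const.
    rewrite big_const_seq count_predT iter_addr_0 -mulr_natl.
    have := size_group_neq0 => W0; field.
    by rewrite c_neq0 W0.
  rewrite hm_eq mulr_sumr; apply: eq_bigr => i _; rewrite (hS i (ltnW _)) //.
  by rewrite /reynolds; ring.
apply: (coinv_ideal_of_differences Prm) => f Wf l a fR.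
have [ll l_neq0 _] := fR.
have /choice[q qP] : forall i, exists q, (i <= m)%N ->
    [/\ shifted (@hpoly K V) (d + e m) (e i) q, i = m -> hpoly d q &
        forall x, r i (f x) - r i x = l x * q x].
  move=> i; have [im|_] := leqP i m; last by exists (fun=> 0).
  move: im; rewrite leq_eqVlt => /predU1P[->|im].
    have [q [Pq _ qE]] := divided_difference fR Prm.
    by exists q => _; split=> //; right; exists d.
  have [r0|[k kE Pri]] := Pr i im.
    exists (fun=> 0) => _; split=> [|_|x]; [by left|exact: hpoly0|].
    by rewrite !r0 subrr mulr0.
  have [q [Pq q0 qE]] := divided_difference fR Pri.
  exists q => _; split=> // [|iE]; last by rewrite iE ltnn in im.
  case: k kE Pri Pq q0 => [|k] kE Pri Pq q0; first by left; exact: q0.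
  by right; exists k => //; move: kE; rewrite !addSn => -[].
exists (q m); last by have [] := qP m (leqnn m).
apply: IHd => // [i im||x].
- by have [] := qP i (ltnW im).
- by have [_ /(_ erefl)] := qP m (leqnn m).
apply: contrapT => relq.
have Phq : hpoly (d + e m) (fun x => \sum_(i < m.+1) h i x * q i x).
  apply: hpoly_sum => i _; have im : (i <= m)%N by rewrite -ltnS.
  have [Phi _] := Sh i im; have [[q0|[k <- Pqi]] _ _] := qP i im.
    by apply: hpoly_ext (hpoly0 _ _) => y; rewrite q0 mulr0.
  by rewrite addnC; exact: hpolyM.
have [] := hpoly_mul_neq0 (hpoly_form ll) Phq l_neq0.
  by exists x; apply/eqP.
move=> y; rewrite mulr_sumr.
rewrite (eq_bigr (fun i : 'I_m.+1 => h i (f y) * r i (f y) - h i y * r i y)).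
  by rewrite sumrB !rel subrr eqxx.
move=> i _; have im : (i <= m)%N by rewrite -ltnS.
have [_ ->//] := Sh i im; have [_ _ qE] := qP i im.
by rewrite -mulrBr qE mulrCA.
Qed.

End FiniteLinearGroups.

(** * Equivariant polynomial maps *)

Section Relations.
Variables (K : numClosedFieldType) (V : vectType K).

Lemma hpoly_exp k (l : V -> K) : linear_form l -> hpoly k (fun x => l x ^+ k).
Proof.
move=> ll; elim: k => [|k IHk]; first exact: hpoly_const.
by apply: hpoly_ext (hpoly_formM ll IHk) => x; rewrite exprS.
Qed.

(** More vectors than coordinates, over the polynomials: Gaussian elimination
    without denominators, [D - dd i] being the degree of the [i]-th
    coefficient. *)
Lemma homogeneous_relation (I : eqType) n (r : seq I) (dd : I -> nat)
    (a : I -> nat -> V -> K) (l : V -> K) :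
  linear_form l -> (exists x, l x != 0) -> uniq r -> (n < size r)%N ->
  {in r, forall i j, (j < n)%N -> hpoly (dd i) (a i j)} ->
  exists D (e : I -> nat) (g : I -> V -> K),
    [/\ {in r, forall i, (e i + dd i)%N = D /\ hpoly (e i) (g i)},
        (exists2 i, i \in r & exists x, g i x != 0) &
        forall j x, (j < n)%N -> \sum_(i <- r) g i x * a i j x = 0].
Proof.
move=> ll [x0 lx0]; elim: n => [|n IHn] in r dd a * => ur.
  case: r ur => // i0 r ur _ _; pose D := \sum_(i <- i0 :: r) dd i.
  have leD i : i \in i0 :: r -> (dd i <= D)%N.
    by move=> ir; rewrite /D (big_rem i) //= leq_addr.
  exists D, (fun i => D - dd i)%N.
  exists (fun i x => if i == i0 then l x ^+ (D - dd i) else 0).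
  split=> // [i ir|].
    split; first by rewrite subnK ?leD.
    by case: eqP => _; [exact: hpoly_exp|exact: hpoly0].
  exists i0; first exact: mem_head.
  by exists x0; rewrite eqxx expf_neq0.
move=> lt_nr Pa; have Pa' : {in r, forall i j, (j < n)%N -> hpoly (dd i) (a i j)}.
  by move=> i ir j jn; apply: Pa => //; exact: ltnW.
have [[i0 [i0r [x1 ax1]]]|no] := pselect (exists i, i \in r /\ exists x, a i n x != 0);
  last first.
  have [D [e [g [Pg nzg rg]]]] := IHn r dd a ur (ltnW lt_nr) Pa'.
  exists D, e, g; split=> // j x.
  rewrite ltnS leq_eqVlt => /predU1P[->|]; last exact: rg.
  rewrite big_seq big1 // => i ir; apply/eqP; rewrite mulf_eq0; apply/orP; right.
  by apply: contrapT => /negP ai; apply: no; exists i; split=> //; exists x.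
have Pi0 : hpoly (dd i0) (a i0 n) by exact: Pa.
(* The pivot [a i0 n] clears column [n] of the other rows. *)
have [||D [e [g [Pg [i1 i1r nzg] rg]]]] := IHn (rem i0 r) (fun i => dd i + dd i0)%N
    (fun i j x => a i0 n x * a i j x - a i n x * a i0 j x) (rem_uniq _ ur).
- by rewrite size_rem //; lia.
- move=> i /mem_rem ir j jn; apply: hpolyB.
    by rewrite addnC; apply: hpolyM => //; exact: Pa'.
  by apply: hpolyM; [exact: Pa|exact: Pa'].
have leD : (dd i0 <= D)%N by have [<- _] := Pg _ i1r; lia.
have i0rem i : i \in rem i0 r -> (i == i0) = false.
  by move=> ir; apply: contraTF ir => /eqP ->; rewrite mem_rem_uniqF.
exists D, (fun i => if i == i0 then (D - dd i0)%N else (e i + dd i0)%N).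
exists (fun i x => if i == i0 then - \sum_(i' <- rem i0 r) g i' x * a i' n x
                   else g i x * a i0 n x).
have sumE j x : \sum_(i <- r) (if i == i0 then
      - \sum_(i' <- rem i0 r) g i' x * a i' n x else g i x * a i0 n x) * a i j x =
    \sum_(i <- rem i0 r) g i x * (a i0 n x * a i j x - a i n x * a i0 j x).
  rewrite (big_rem i0) //= eqxx mulNr mulr_suml -sumrN -big_split /=.
  apply: eq_big_seq => i /i0rem ->; ring.
split=> [i ir||j x].
- have [ii0|ii0] := eqVneq i i0.
    split; first by rewrite ii0 subnK.
    apply: hpoly_ext (hpolyZ (-1) (_ : hpoly _ (fun x =>
      \sum_(i' <- rem i0 r) g i' x * a i' n x))) => [x|]; first by rewrite mulN1r.
    rewrite (_ : (fun x => _) = fun x => \sum_(i' <- rem i0 r | i' \in rem i0 r)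
      g i' x * a i' n x); last by apply: funext => x; rewrite big_seq.
    apply: hpoly_sum => i' i'r; have [eE Pg'] := Pg _ i'r.
    rewrite (_ : (D - dd i0)%N = (e i' + dd i')%N); last by lia.
    by apply: hpolyM => //; apply: Pa => //; exact: mem_rem i'r.
  have irr : i \in rem i0 r by rewrite mem_rem_uniq // inE ii0.
  have [eE Pgi] := Pg _ irr; split; last exact: hpolyM.
  by rewrite -addnA [(dd i0 + _)%N]addnC.
- exists i1; first exact: mem_rem i1r.
  rewrite i0rem //; have [_ Pg1] := Pg _ i1r.
  by apply: hpoly_mul_neq0 Pg1 Pi0 nzg _; exists x1.
- rewrite ltnS leq_eqVlt sumE => /predU1P[->|jn]; last exact: rg.
  by rewrite big1 // => i _; rewrite mulrC [a i0 n x * _]mulrC subrr mul0r.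
Qed.

End Relations.

Section EquivariantMaps.
Variables (K : numClosedFieldType) (V : vectType K) (W : seq 'End(V)).
Implicit Types (p q r s l : V -> K) (phi psi : V -> V) (d e k : nat).
Hypothesis groupW : finite_linear_group W.

Definition hmap d phi := forall l, linear_form l -> hpoly d (fun x => l (phi x)).

Lemma hmapD d phi psi :
  hmap d phi -> hmap d psi -> hmap d (fun x => phi x + psi x).
Proof.
move=> Pp Pq l ll; apply: hpoly_ext (hpolyD (Pp l ll) (Pq l ll)) => x.
by rewrite linear_formD.
Qed.

Lemma hmap_scale d e s phi :
  hpoly e s -> hmap d phi -> hmap (e + d) (fun x => s x *: phi x).
Proof.
move=> Ps Pp l ll; apply: hpoly_ext (hpolyM Ps (Pp l ll)) => x.
by rewrite linear_formZ.
Qed.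

Lemma hmap_vect d p v : hpoly d p -> hmap d (fun x => p x *: v).
Proof.
move=> Pp l ll; apply: hpoly_ext (hpolyZ (l v) Pp) => x.
by rewrite linear_formZ // mulrC.
Qed.

Definition equivariant d phi := hmap d phi /\
  forall w x, w \in W -> phi (w x) = w (phi x).

Lemma equivariantD d phi psi : equivariant d phi -> equivariant d psi ->
  equivariant d (fun x => phi x + psi x).
Proof.
move=> [Pp Ep] [Pq Eq]; split=> [|w x Ww]; first exact: hmapD.
by rewrite Ep // Eq // linearD.
Qed.

Lemma equivariant_scale e d s phi : invp W e s -> equivariant d phi ->
  equivariant (e + d) (fun x => s x *: phi x).
Proof.
move=> [Ps Is] [Pp Ep]; split=> [|w x Ww]; first exact: hmap_scale.
by rewrite Is // Ep // linearZ.
Qed.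

(** Left unnormalized; [decomposable_of_coords] divides by the order of the
    group. *)
Definition average psi x := \sum_(w <- W) (w^-1)%VF (psi (w x)).

Lemma average_equivariant d psi : hmap d psi -> equivariant d (average psi).
Proof.
move=> Pp; split=> [l ll|h x Wh].
  apply: hpoly_ext (_ : hpoly d (fun x => \sum_(w <- W) l ((w^-1)%VF (psi (w x))))).
    by move=> x; rewrite /average linear_form_sum.
  apply: hpoly_sum => w _; apply: (hpoly_comp w (p := fun x => l ((w^-1)%VF (psi x)))).
  exact: Pp _ (linear_form_comp _ ll).
rewrite /average linear_sum /=.
rewrite -[in RHS](perm_big _ (group_mulr_perm groupW Wh)) big_map.
apply: eq_big_seq => w Ww; have [_ wK wKV] := group_inv groupW Ww.
have [_ hK hKV] := group_inv groupW Wh.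
have Wwh : (w \o h)%VF \in W by case: groupW => _ _ WM _; exact: WM.
have [_ whK whKV] := group_inv groupW Wwh.
rewrite [(w \o h)%VF x]comp_lfunE; apply: (group_inj groupW Ww).
by rewrite wKV -[in RHS]comp_lfunE whKV.
Qed.

(** The submodule of the module of equivariant maps generated by its multiples
    by invariants of positive degree. *)
Inductive decomposable : nat -> (V -> V) -> Prop :=
| decomposable0 d : decomposable d (fun=> 0)
| decomposableD d phi psi : decomposable d phi -> decomposable d psi ->
    decomposable d (fun x => phi x + psi x)
| decomposableM d e k s phi : invp W e s -> (0 < e)%N -> equivariant k phi ->
    d = (e + k)%N -> decomposable d (fun x => s x *: phi x).

Lemma decomposable_ext d phi psi :
  phi =1 psi -> decomposable d phi -> decomposable d psi.
Proof. by move=> /funext ->. Qed.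

Lemma decomposableZ d c phi :
  decomposable d phi -> decomposable d (fun x => c *: phi x).
Proof.
elim=> {d phi} [d|d phi psi _ IHp _ IHq|d e k s phi Ss e0 Ep dE].
- by apply: decomposable_ext (decomposable0 d) => x; rewrite scaler0.
- by apply: decomposable_ext (decomposableD IHp IHq) => x; rewrite scalerDr.
- apply: decomposable_ext (decomposableM (invpZ c Ss) e0 Ep dE) => x.
  by rewrite scalerA.
Qed.

Lemma decomposableB d phi psi : decomposable d phi -> decomposable d psi ->
  decomposable d (fun x => phi x - psi x).
Proof.
move=> Np Nq; apply: decomposable_ext (decomposableD Np (decomposableZ (-1) Nq)).
by move=> x; rewrite scaleN1r.
Qed.

Lemma decomposable_sum d I (r : seq I) (P : pred I) (F : I -> V -> V) :
  (forall i, P i -> decomposable d (F i)) ->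
  decomposable d (fun x => \sum_(i <- r | P i) F i x).
Proof.
move=> PF; elim: r => [|i r IHr].
  by apply: decomposable_ext (decomposable0 d) => x; rewrite big_nil.
case Pi: (P i); last by apply: decomposable_ext IHr => x; rewrite big_cons Pi.
by apply: decomposable_ext (decomposableD (PF i Pi) IHr) => x; rewrite big_cons Pi.
Qed.

Lemma decomposable_average d p v : coinv_ideal W d p ->
  decomposable d (average (fun x => p x *: v)).
Proof.
elim=> {d p} [d|d p q _ IHp _ IHq|d e k s r Ss e0 Pr dE].
- apply: decomposable_ext (decomposable0 d) => x.
  by rewrite /average big1 // => w _; rewrite scale0r linear0.
- apply: decomposable_ext (decomposableD IHp IHq) => x.
  by rewrite /average -big_split; apply: eq_bigr => w _; rewrite scalerDl linearD.
- apply: decomposable_ext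
    (decomposableM Ss e0 (average_equivariant (hmap_vect v Pr)) dE).
  move=> x; rewrite /average scaler_sumr; apply: eq_big_seq => w Ww.
  by rewrite -linearZ scalerA; have [_ ->] := Ss.
Qed.

(** For an equivariant map, decomposability can be tested on coordinates, as the
    map is its own average up to a scalar. *)
Lemma decomposable_of_coords d phi : equivariant d phi ->
  (forall l, linear_form l -> coinv_ideal W d (fun x => l (phi x))) ->
  decomposable d phi.
Proof.
move=> [_ Ep] Ip; have W0 := size_group_neq0 groupW.
have Ni i : decomposable d (average (fun x => coord_form i (phi x) *:
    (vbasis {:V})`_i)).
  by apply: decomposable_average; apply: Ip; exact: coord_form_linear.
have := decomposable_sum (index_enum _) (fun i (_ : predT i) => Ni i).
move=> /(decomposableZ (size W)%:R^-1); apply: decomposable_ext => x.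
rewrite exchange_big /=.
rewrite (eq_big_seq (fun=> phi x)) => [|w Ww] /=; last first.
  have [_ wK _] := group_inv groupW Ww.
  by rewrite -linear_sum -coord_form_expand Ep //; exact: wK.
rewrite big_const_seq count_predT iter_addr_0 -[phi x *+ _]scaler_nat.
by rewrite scalerA mulVf ?scale1r.
Qed.

(** A family whose classes modulo the decomposable maps are linearly
    independent, degree by degree. *)
Definition minimal_family m (dd : nat -> nat) (theta : nat -> V -> V) :=
  (forall i, (i < m)%N -> equivariant (dd i) (theta i)) /\
  forall D (c : nat -> K),
    decomposable D (fun x => \sum_(i < m | dd i == D) c i *: theta i x) ->
    forall i, (i < m)%N -> dd i = D -> c i = 0.

Hypothesis refl_gen : reflection_generated W.

(** If the last coefficient of a relation is not in the ideal generated by the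
    others, Chevalley's lemma makes the last map decomposable; otherwise it
    can be eliminated without affecting minimality. *)
Lemma minimal_family_invariant_free m dd theta D (e : nat -> nat)
    (h : nat -> V -> K) :
  minimal_family m dd theta ->
  (forall i, (i < m)%N -> invp W (e i) (h i) /\ (e i + dd i)%N = D) ->
  (forall x, \sum_(i < m) h i x *: theta i x = 0) ->
  forall i x, (i < m)%N -> h i x = 0.
Proof.
elim: m => [//|m IHm] in theta * => -[Et minT] Sh rel.
have [Shm hmD] := Sh m (ltnSn m).
have [[b [Sb hm]]|no_b] := pselect (exists b : nat -> V -> K,
      (forall i, (i < m)%N -> shifted (invp W) (e m) (e i) (b i)) /\
      forall x, h m x = \sum_(i < m) b i x * h i x); last first.
  suff Nm : decomposable (dd m) (fun x =>
      \sum_(i < m.+1 | dd i == dd m) (i == m :> nat)%:R *: theta i x).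
    have /eqP := minT _ (fun i => (i == m)%:R) Nm m (ltnSn m) erefl.
    by rewrite eqxx oner_eq0.
  apply: decomposable_ext (_ : decomposable (dd m) (theta m)) => [x|].
    rewrite big_mkcond big_ord_recr /= !eqxx scale1r big1 ?add0r // => i _.
    by rewrite (ltn_eqF (ltn_ord i)) scale0r if_same.
  apply: decomposable_of_coords => [|l ll]; first exact: Et.
  apply: (chevalley_relation groupW refl_gen (m := m) (e := e) (h := h)
    (r := fun i x => l (theta i x))) no_b => [i im|i im||x].
  - by have [] := Sh i im.
  - right; exists (dd i); first by have [_] := Sh i (ltnW im); lia.
    by have [Pt _] := Et i (ltnW im); exact: Pt.
  - by have [Pt _] := Et m (ltnSn m); exact: Pt.
  - rewrite -[RHS](linear_form0 ll) -(rel x) linear_form_sum //.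
    by apply: eq_bigr => i _; rewrite linear_formZ.
have b_shift i : (i < m)%N -> (forall x, b i x = 0) \/
    exists2 k, (k + dd m)%N = dd i & invp W k (b i).
  move=> im; have [b0|[k kE Sk]] := Sb i im; [by left|right].
  by exists k => //; have [_] := Sh i (ltnW im); lia.
(* As [h m] is the combination of the [h i] with coefficients [b i], the
   relation involves the [theta' i] only, which are homogeneous again. *)
pose theta' i x := theta i x + b i x *: theta m x.
have min' : minimal_family m dd theta'.
  split=> [i im|D' c Nc i im ddi].
    have Ei := Et i (ltnW im); have [b0|[k kE Sk]] := b_shift i im.
      rewrite (_ : theta' i = theta i) //; apply: funext => x.
      by rewrite /theta' b0 scale0r addr0.
    apply: equivariantD => //; rewrite -kE; apply: equivariant_scale => //.
    exact: Et.
  have thetaE x : \sum_(j < m | dd j == D') c j *: theta j x =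
      \sum_(j < m | dd j == D') c j *: theta' j x -
      (\sum_(j < m | dd j == D') c j * b j x) *: theta m x.
    rewrite scaler_suml -sumrB; apply: eq_bigr => j _.
    by rewrite /theta' scalerDr scalerA addrK.
  (* Modulo decomposable maps only the constant [b j] contribute, which occur
     when [theta m] has degree [D']. *)
  pose c' i := if i == m then \sum_(j < m | dd j == D') c j * b j 0 else c i.
  suff : c' i = 0 by rewrite /c' (ltn_eqF im).
  apply: (minT D') (ltnW im) ddi.
  have sumE x : \sum_(j < m.+1 | dd j == D') c' j *: theta j x =
      \sum_(j < m | dd j == D') c j *: theta j x +
      (if dd m == D' then c' m *: theta m x else 0).
    rewrite big_mkcond big_ord_recr /= -big_mkcond /=; congr (_ + _).
    by apply: eq_bigr => j _; rewrite /c' (ltn_eqF (ltn_ord j)).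
  have [dm|dm] := eqVneq (dd m) D'.
    apply: decomposable_ext Nc => x; rewrite sumE dm eqxx thetaE /c' eqxx.
    rewrite -addrA -[LHS]addr0; congr (_ + _); apply/esym/eqP.
    rewrite addrC subr_eq0; apply/eqP; congr (_ *: _); apply: eq_bigr => j /eqP dj.
    congr (_ * _); have [b0|[k kE [Pk _]]] := b_shift j (ltn_ord j).
      by rewrite !b0.
    by rewrite [RHS](hpoly_constant Pk) //; lia.
  apply: decomposable_ext (decomposableB Nc (_ : decomposable D' (fun x =>
    \sum_(j < m | dd j == D') c j *: (b j x *: theta m x)))) => [x|].
    rewrite sumE (negPf dm) addr0 thetaE scaler_suml; congr (_ - _).
    by apply: eq_bigr => j _; rewrite scalerA.
  apply: decomposable_sum => j /eqP dj; apply: decomposableZ.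
  have [b0|[k kE Sk]] := b_shift j (ltn_ord j).
    by apply: decomposable_ext (decomposable0 _) => x; rewrite b0 scale0r.
  apply: (decomposableM Sk) (Et m (ltnSn m)) _; last by rewrite kE.
  by rewrite lt0n; apply: contra dm => /eqP k0; rewrite -dj -kE k0 add0n.
have h0 : forall i x, (i < m)%N -> h i x = 0.
  apply: (IHm _ min') => [i im|x]; first exact: Sh (ltnW im).
  rewrite -[RHS](rel x) big_ord_recr /= hm scaler_suml -big_split /=.
  by apply: eq_bigr => i _; rewrite /theta' scalerDr scalerA mulrC.
move=> i x; rewrite ltnS leq_eqVlt => /predU1P[->|]; last exact: h0.
by rewrite hm big1 // => j _; rewrite h0 // mulr0.
Qed.

(** A relation with arbitrary coefficients can be averaged into one with
    invariant coefficients; multiplying first by the conjugates of one of the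
    coefficients keeps that one nonzero. *)
Lemma minimal_family_free m dd theta D (e : nat -> nat) (g : nat -> V -> K) :
  minimal_family m dd theta ->
  (forall i, (i < m)%N -> hpoly (e i) (g i) /\ (e i + dd i)%N = D) ->
  (forall x, \sum_(i < m) g i x *: theta i x = 0) ->
  forall i x, (i < m)%N -> g i x = 0.
Proof.
move=> minT Pg rel i0 x0 i0m; apply/eqP; apply: contrapT => /negP gx0.
have [_ W1 WM _] := groupW.
(* [a * g i0] is the norm of [g i0], hence invariant and nonzero. *)
pose a x := \prod_(w <- rem \1%VF W) g i0 (w x).
have Pa : hpoly (\sum_(w <- rem \1%VF W) e i0) a.
  by apply: hpoly_prod => w; apply: hpoly_comp; have [] := Pg i0 i0m.
set A := (\sum_(w <- _) _)%N in Pa.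
pose h i x := \sum_(w <- W) a (w x) * g i (w x).
have Sh i : (i < m)%N -> invp W (A + e i) (h i) /\ (A + e i + dd i)%N = (A + D)%N.
  move=> im; have [Pgi <-] := Pg i im; rewrite addnA; split=> //.
  exact: (invp_sum groupW (hpolyM Pa Pgi)).
have relh x : \sum_(i < m) h i x *: theta i x = 0.
  under eq_bigr do rewrite scaler_suml.
  rewrite exchange_big big_seq big1 //= => w Ww.
  under eq_bigr do rewrite -scalerA.
  rewrite -scaler_sumr; suff -> : \sum_(i < m) g i (w x) *: theta i x = 0.
    by rewrite scaler0.
  apply: (group_inj groupW Ww); rewrite linear0 -[RHS](rel (w x)) linear_sum.
  apply: eq_bigr => i _; rewrite linearZ; have [Et _] := minT.
  by have [_ ->] := Et i (ltn_ord i).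
have h0 x := minimal_family_invariant_free minT Sh relh x i0m.
have hE x : h i0 x = (size W)%:R * \prod_(w <- W) g i0 (w x).
  rewrite /h (eq_big_seq (fun=> \prod_(w <- W) g i0 (w x))) => [|w Ww] /=.
    by rewrite big_const_seq count_predT iter_addr_0 mulr_natl.
  rewrite -[RHS](perm_big _ (group_mulr_perm groupW Ww)) big_map.
  rewrite (big_rem _ W1) /= comp_lfunE id_lfunE mulrC; congr (_ * _).
  by apply: eq_bigr => w' _; rewrite comp_lfunE.
have [||x] := @hpoly_prod_neq0 K V 'End(V) W
  (fun w x => if w \in W then g i0 (w x) else 1).
- move=> w; case: (w \in W); last by exists 0%N; exact: hpoly_const.
  by exists (e i0); apply: hpoly_comp; have [] := Pg i0 i0m.
- move=> w; case: (boolP (w \in W)) => [Ww|_]; last by exists 0; exact: oner_neq0.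
  by have [_ _ wK] := group_inv groupW Ww; exists ((w^-1)%VF x0); rewrite wK.
rewrite (eq_big_seq (fun w : 'End(V) => g i0 (w x))) => [|w ->//].
have /eqP := h0 x; rewrite hE mulf_eq0 (negPf (size_group_neq0 groupW)) /=.
by move=> ->.
Qed.

Lemma minimal_family_size m dd theta :
  minimal_family m dd theta -> (m <= \dim {:V})%N.
Proof.
move=> minT; rewrite leqNgt; apply/negP => lt_nm; have [Et minN] := minT.
have [n0|n_gt0] := posnP (\dim {:V}).
  have V0 (v : V) : v = 0.
    rewrite (coord_form_expand v) big1 // => j; have := ltn_ord j.
    by rewrite [X in (_ < X)%N]n0.
  have N0 : decomposable (dd 0%N)
      (fun x => \sum_(i < m | dd i == dd 0%N) 1 *: theta i x).
    by apply: decomposable_ext (decomposable0 _) => x; rewrite [RHS]V0.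
  have /eqP := minN _ (fun=> 1) N0 0%N (leq_ltn_trans (leq0n _) lt_nm) erefl.
  by rewrite oner_eq0.
pose j0 := Ordinal n_gt0.
pose a i j x := if insub j is Some j' then
  coord_form (j' : 'I_(\dim {:V})) (theta i x) else 0.
have nz0 : exists x, coord_form j0 x != 0.
  exists (vbasis {:V})`_j0; rewrite /coord_form coord_free ?eqxx ?oner_neq0 //.
  exact: basis_free (vbasisP _).
have [||D [e [g [Pg [i ir [x gx]] rel]]]] := @homogeneous_relation K V nat
  (\dim {:V}) (iota 0 m) dd a (coord_form j0) (@coord_form_linear K V j0) nz0
  (iota_uniq _ _).
- by rewrite size_iota.
- move=> i; rewrite mem_iota add0n => /andP[_ im] j jn; rewrite /a insubT.
  by have [Pt _] := Et i im; apply: Pt; exact: coord_form_linear.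
have im : (i < m)%N by move: ir; rewrite mem_iota.
suff g0 : g i x = 0 by rewrite g0 eqxx in gx.
apply: (minimal_family_free minT (e := e) (D := D)) im => [i' im'|y].
  by have [] := Pg i'; rewrite ?mem_iota.
rewrite [LHS]coord_form_expand big1 // => j _.
rewrite (linear_form_sum _ _ _ (@coord_form_linear K V j)).
rewrite (_ : \sum_(i < m) _ = 0) ?scale0r //.
rewrite -[RHS](rel j y (ltn_ord j)) -[m in iota _ m]subn0.
rewrite -[LHS](big_mkord predT (fun i => coord_form j (g i y *: theta i y))).
apply: eq_bigr => i' _; rewrite /a valK linear_formZ //.
exact: coord_form_linear.
Qed.

(** A dependence between [phi] and the family modulo decomposable maps has a
    nonzero coefficient at [phi], hence would express [phi]. *)
Lemma minimal_family_extend m dd theta d phi :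
  minimal_family m dd theta -> equivariant d phi ->
  (forall c : nat -> K,
     ~ decomposable d (fun x => phi x - \sum_(i < m | dd i == d) c i *: theta i x)) ->
  minimal_family m.+1 (fun i => if i == m then d else dd i)
                      (fun i => if i == m then phi else theta i).
Proof.
move=> [Et minT] Ep ndec; split=> [i|D c Nc].
  by rewrite ltnS leq_eqVlt; case: eqVneq => //= _; exact: Et.
have sumE x : \sum_(i < m.+1 | (if i == m :> nat then d else dd i) == D)
      c i *: (if i == m :> nat then phi else theta i) x =
    \sum_(i < m | dd i == D) c i *: theta i x + (if d == D then c m *: phi x else 0).
  rewrite big_mkcond big_ord_recr /= eqxx; congr (_ + _); rewrite -big_mkcond /=.
  have im (i : 'I_m) : (i == m :> nat) = false by rewrite (ltn_eqF (ltn_ord i)).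
  apply: eq_big => [i|i _]; by rewrite im.
have cm : d = D -> c m = 0.
  move=> dD; apply/eqP; apply: contrapT => /negP cm0.
  apply: (ndec (fun i => - (c m)^-1 * c i)); rewrite dD.
  apply: decomposable_ext (decomposableZ (c m)^-1 Nc) => x; rewrite sumE dD eqxx.
  rewrite scalerDr scalerA mulVf // scale1r addrC; congr (_ + _).
  rewrite scaler_sumr -sumrN; apply: eq_bigr => i _.
  by rewrite scalerA mulNr scaleNr opprK.
have {}Nc : decomposable D (fun x => \sum_(i < m | dd i == D) c i *: theta i x).
  apply: decomposable_ext Nc => x; rewrite sumE.
  by case: eqP => [/cm ->|_]; rewrite ?scale0r addr0.
move=> i; rewrite ltnS leq_eqVlt; case: eqVneq => [-> _|_ /=]; first exact: cm.
exact: minT Nc i.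
Qed.

Definition generating m (theta : nat -> V -> V) := forall d phi, equivariant d phi ->
  exists s : nat -> V -> K, forall x, phi x = \sum_(i < m) s i x *: theta i x.

(** A minimal family of maximal size generates, by a graded form of Nakayama's
    lemma: by maximality a homogeneous equivariant map is a combination of the
    family up to a decomposable map, whose factors have lower degree.  Sizes
    are bounded because minimal families are independent over the
    polynomials. *)
Lemma generating_family_exists : exists m (dd : nat -> nat) theta,
  [/\ (m <= \dim {:V})%N, forall i, (i < m)%N -> equivariant (dd i) (theta i) &
      generating m theta].
Proof.
have [m [[dd [theta minT]] max_m]] : exists m,
    (exists dd theta, minimal_family m dd theta) /\
    forall dd theta, ~ minimal_family m.+1 dd theta.
  apply: contrapT => /forallNP no.
  have all_m m : exists dd theta, minimal_family m dd theta.
    elim: m => [|m IHm]; first by exists (fun=> 0%N), (fun _ _ => 0); split.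
    apply: contrapT => nexts; apply: (no m); split=> // dd theta minT.
    by apply: nexts; exists dd, theta.
  have [dd [theta /minimal_family_size]] := all_m (\dim {:V}).+1.
  by rewrite ltnn.
have [Et _] := minT; exists m, dd, theta; split=> //.
  exact: minimal_family_size minT.
move=> d; have [n le_dn] := ubnP d; elim: n => // n IHn in d le_dn * => phi Ep.
have [c Nc] : exists c : nat -> K, decomposable d
    (fun x => phi x - \sum_(i < m | dd i == d) c i *: theta i x).
  apply: contrapT => /forallNP nc.
  exact: max_m _ _ (minimal_family_extend minT Ep nc).
suff gen_dec psi : decomposable d psi -> exists s : nat -> V -> K,
    forall x, psi x = \sum_(i < m) s i x *: theta i x.
  have [s sE] := gen_dec _ Nc.
  exists (fun i x => s i x + (if dd i == d then c i else 0)) => x.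
  rewrite -[LHS](subrK (\sum_(i < m | dd i == d) c i *: theta i x)) sE.
  rewrite [X in _ + X]big_mkcond -big_split /=; apply: eq_bigr => i _.
  by case: ifP; rewrite scalerDl // scale0r.
clear phi Ep c Nc => dec_psi.
elim: dec_psi le_dn => {d psi} [d|d phi psi _ IHp _ IHq|d e k s phi _ e0 Ep ->] le_dn.
- by exists (fun _ _ => 0) => x; rewrite big1 // => i _; rewrite scale0r.
- have [[s sE] [s' s'E]] := (IHp le_dn, IHq le_dn).
  exists (fun i x => s i x + s' i x) => x; rewrite sE s'E -big_split /=.
  by apply: eq_bigr => i _; rewrite scalerDl.
- have [|s' s'E] := IHn k _ phi Ep; first by move: le_dn e0; lia.
  exists (fun i x => s x * s' i x) => x; rewrite s'E scaler_sumr.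
  by apply: eq_bigr => i _; rewrite scalerA.
Qed.

Definition regular_point x := forall w : 'End(V), w \in W -> w x = x -> w = \1%VF.

(** A product of affine functions, split into its homogeneous components. *)
Lemma affine_product (I : eqType) (r : seq I) (l : I -> V -> K) (c : I -> K) :
  {in r, forall i, linear_form (l i)} ->
  exists p : nat -> V -> K, (forall j, hpoly j (p j)) /\
    forall x, \prod_(i <- r) (l i x + c i) = \sum_(j < (size r).+1) p j x.
Proof.
elim: r => [|i r IHr] lr.
  exists (fun j x => if j == 0%N then 1 else 0); split=> [[|j]|x] /=.
  - exact: hpoly_const.
  - exact: hpoly0.
  - by rewrite big_nil big_ord1.
have [|p [Pp pE]] := IHr; first by move=> j jr; apply: lr; rewrite inE jr orbT.
have li : linear_form (l i) by apply: lr; exact: mem_head.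
exists (fun j x => (if j is j'.+1 then l i x * p j' x else 0) +
                   (if (j <= size r)%N then c i * p j x else 0)); split=> [j|x].
  apply: hpolyD; first by case: j => [|j]; [exact: hpoly0|exact: hpoly_formM].
  by case: (j <= size r)%N; [exact: hpolyZ|exact: hpoly0].
rewrite big_cons pE mulrDl !mulr_sumr big_split /=; congr (_ + _).
  by rewrite [RHS]big_ord_recl add0r.
rewrite [RHS]big_ord_recr /= ltnn addr0; apply: eq_bigr => j _.
by rewrite -ltnS ltn_ord.
Qed.

(** Averaging a polynomial that separates a regular point from the rest of its
    orbit produces equivariant maps with arbitrary value at that point. *)
Lemma equivariant_interpolation x u : regular_point x ->
  exists n (phi : nat -> V -> V), (forall j, equivariant j (phi j)) /\
    u = \sum_(j < n) phi j x.
Proof.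
move=> xreg; have [W_uniq W1 _ _] := groupW.
have /choice[l lP] : forall w : 'End(V), exists l : V -> K,
    w \in rem \1%VF W -> linear_form l /\ l x != l (w x).
  move=> w; have [wr|_] := boolP (w \in rem \1%VF W); last by exists (fun=> 0).
  have [j jP] : exists j, coord_form j (w x) != coord_form j x.
    apply: contrapT => /forallNP eqj; move: wr; rewrite mem_rem_uniq // inE.
    case/andP => /eqP w1 Ww; apply: w1; apply: xreg => //.
    rewrite (coord_form_expand (w x)) [RHS]coord_form_expand.
    apply: eq_bigr => j _; congr (_ *: _).
    by have /negP/negPn/eqP := eqj j.
  by exists (coord_form j) => _; split; [exact: coord_form_linear|rewrite eq_sym].
have [|p [Pp pE]] := @affine_product _ (rem \1%VF W) l (fun w => - l w (w x)).
  by move=> w /lP[].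
pose P y := \prod_(w <- rem \1%VF W) (l w y - l w (w x)).
have Px : P x != 0.
  rewrite prodf_seq_neq0; apply/allP => w /lP[_] /=.
  by rewrite subr_eq0.
have Pwx w : w \in W -> w != \1%VF -> P (w x) = 0.
  move=> Ww w1; have wr : w \in rem \1%VF W by rewrite mem_rem_uniq // inE w1.
  by rewrite /P (big_rem _ wr) /= subrr mul0r.
exists (size (rem \1%VF W)).+1.
exists (fun j => average (fun y => p j y *: ((P x)^-1 *: u))); split=> [j|].
  by apply: average_equivariant; exact: hmap_vect.
rewrite /average exchange_big /= (big_rem _ W1) /=.
rewrite [X in _ + X]big_seq [X in _ + X]big1 => [|w wr]; last first.
  rewrite -linear_sum -scaler_suml -pE -/(P _).
  move: wr; rewrite mem_rem_uniq // inE => /andP[w1 Ww].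
  by rewrite Pwx // scale0r linear0.
rewrite -linear_sum -scaler_suml -pE -/(P _) id_lfunE scalerA mulfV // scale1r addr0.
have [_ K1 _] := group_inv groupW W1.
by rewrite -[u in LHS]K1 id_lfunE.
Qed.

End EquivariantMaps.

(** * The equivariant frame *)

Section Frame.
Variables (K : numClosedFieldType) (V : vectType K) (W : seq 'End(V)).
Hypothesis groupW : finite_linear_group W.
Hypothesis refl_gen : reflection_generated W.

Lemma hyperplane_form (U : {vspace V}) : (\dim U).+1 = \dim {:V} ->
  exists m : V -> K, [/\ linear_form m, (exists y, m y != 0) &
                         forall v, (v \in U) = (m v == 0)].
Proof.
move=> dimU; have [|m [lm [y my] mU]] := @subspace_form K V U; first by rewrite -dimU.
exists m; split=> // [|v]; first by exists y.
apply/idP/eqP => [/mU //|mv].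
have yU : y \notin U by apply: contra my => /mU ->.
have /eqP UyV : (U + <[y]>)%VS == {:V}%VS.
  rewrite eqEdim subvf /= -dimU ltnNge.
  have [leU eqU] := dimv_leqif_sup (addvSl U <[y]>).
  apply/negP => geU; move/negP: yU; apply.
  have : (U + <[y]> <= U)%VS by rewrite -eqU eqn_leq leU.
  by rewrite subv_add -memvE => /andP[].
have : v \in (U + <[y]>)%VS by rewrite UyV memvf.
case/memv_addP => u uU [_ /vlineP[a ->] vE].
move: mv; rewrite vE linear_formD // linear_formZ // (mU u uU) add0r => /eqP.
by rewrite mulf_eq0 (negPf my) orbF => /eqP ->; rewrite scale0r addr0.
Qed.

Lemma fixedSpace_proper (w : 'End(V)) : w != \1%VF ->
  (\dim (fixedSpace w) < \dim {:V})%N.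
Proof.
move=> w1; have [_ ltE] := dimv_leqif_sup (subvf (fixedSpace w)).
rewrite ltn_neqAle dimvS ?subvf // andbT ltE.
apply: contra w1 => /subvP fixT; apply/eqP/lfunP => x.
by rewrite id_lfunE; apply/fixedSpaceP/fixT/memvf.
Qed.

Lemma regular_point_exists : exists x, regular_point W x.
Proof.
have /choice[m mP] : forall w : 'End(V), exists m : V -> K,
    w != \1%VF -> [/\ linear_form m, (exists y, m y != 0) &
      forall v, v \in fixedSpace w -> m v = 0].
  move=> w; have [w1|_] := boolP (w != \1%VF); last by exists (fun=> 0).
  by have [m ?] := subspace_form (fixedSpace_proper w1); exists m.
have [||x] := @hpoly_prod_neq0 K V 'End(V) [seq w <- W | w != \1%VF]
  (fun w x => if w != \1%VF then m w x else 1).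
- move=> w; case: (boolP (w != \1%VF)) => [w1|_].
    by exists 1%N; apply: hpoly_form; have [] := mP w w1.
  by exists 0%N; exact: hpoly_const.
- move=> w; case: (boolP (w != \1%VF)) => [w1|_]; first by have [] := mP w w1.
  by exists 0; exact: oner_neq0.
rewrite prodf_seq_neq0 => /allP xP; exists x => w Ww wx.
apply/eqP; apply: contrapT => /negP w1.
have := xP w; rewrite mem_filter Ww w1 => /(_ isT).
have [_ _ mw] := mP w w1; rewrite mw ?eqxx //; exact/fixedSpaceP.
Qed.

Definition frame_mx m (theta : nat -> V -> V) x : 'M[K]_(m, \dim {:V}) :=
  \matrix_(i, j) coord_form j (theta i x).

(** At a regular point every vector is the value of an equivariant map, hence a
    combination of the values of the generators. *)
Lemma generating_frame_full m theta x : generating W m theta ->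
  regular_point W x -> row_full (frame_mx m theta x).
Proof.
move=> genT xreg; rewrite -sub1mx; apply/row_subP => j.
have [n [phi [Ep jE]]] := equivariant_interpolation groupW ((vbasis {:V})`_j) xreg.
have /choice[s sE] := fun i => genT _ _ (Ep i).
apply/submxP; exists (\row_k \sum_(i < n) s i k x); apply/rowP => k; rewrite !mxE.
rewrite -(coord_free _ _ (basis_free (vbasisP {:V}%VS))) jE -/(coord_form k _).
rewrite linear_form_sum; last exact: coord_form_linear.
transitivity (\sum_(i < n) \sum_(i' < m) s i i' x * coord_form k (theta i' x)).
  apply: eq_bigr => i _; rewrite sE linear_form_sum; last exact: coord_form_linear.
  by apply: eq_bigr => i' _; rewrite linear_formZ //; exact: coord_form_linear.
rewrite exchange_big; apply: eq_bigr => i' _; rewrite !mxE mulr_suml.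
by [].
Qed.

(** The determinant of a generating family vanishes only on the union of the
    spaces fixed by the nontrivial elements of the group, hence only on those
    of codimension one. *)
Theorem equivariant_frame_exists : exists theta : nat -> V -> V,
  (forall i, (i < \dim {:V})%N -> exists d, equivariant W d (theta i)) /\
  forall x, (forall w, w \in W -> (\dim (fixedSpace w)).+1 = \dim {:V} ->
                x \notin fixedSpace w) ->
    frame_mx (\dim {:V}) theta x \in unitmx.
Proof.
have [m [dd [theta [le_mn Et genT]]]] := generating_family_exists groupW refl_gen.
have [x0 x0reg] := regular_point_exists.
have mn : m = \dim {:V}.
  apply/eqP; rewrite eqn_leq le_mn /=.
  have := generating_frame_full genT x0reg; rewrite /row_full => /eqP <-.
  exact: rank_leq_row.
subst m; exists theta; split=> [i im|x xreg]; first by exists (dd i); exact: Et.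
pose J y := \det (frame_mx (\dim {:V}) theta y).
have PJ : hpoly (\sum_(i < \dim {:V}) dd i) J.
  rewrite /J /determinant; apply: hpoly_sum => s _; apply: hpolyZ.
  have Pcoord (i j : 'I_(\dim {:V})) : hpoly (dd i) (fun y => coord_form j (theta i y)).
    by have [Pt _] := Et i (ltn_ord i); apply: Pt; exact: coord_form_linear.
  apply: hpoly_ext (hpoly_prod (index_enum _) (fun i => Pcoord i _)) => y.
  by apply: eq_bigr => i _; rewrite mxE.
pose codim1 (w : 'End(V)) := (\dim (fixedSpace w)).+1 == \dim {:V}.
pose rs := [seq w <- W | codim1 w].
pose os := [seq w <- W | (w != \1%VF) && ~~ codim1 w].
have /choice[l lP] : forall i : 'I_(size rs), exists m : V -> K,
    [/\ linear_form m, (exists y, m y != 0) &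
        forall v, (v \in fixedSpace rs`_i) = (m v == 0)].
  move=> i; apply: hyperplane_form.
  by have := mem_nth 0 (ltn_ord i); rewrite mem_filter => /andP[/eqP].
rewrite unitmxE unitfE -/(J x).
apply: (@hpoly_zeros_on_hyperplanes K V _ J _ 'I_(size os) l
  (fun j => fixedSpace os`_j)) PJ _ _ _ _ _ => [i|i|j|y Jy|i].
- by have [] := lP i.
- by have [] := lP i.
- have := mem_nth 0 (ltn_ord j); rewrite mem_filter => /andP[/andP[w1 ncod] _].
  by rewrite ltn_neqAle ncod fixedSpace_proper.
- have [w [Ww w1 wy]] : exists w, [/\ w \in W, w != \1%VF & w y = y].
    apply: contrapT => /forallNP no; have yreg : regular_point W y.
      move=> w Ww wy; apply/eqP; apply: contrapT => /negP w1.
      by apply: (no w).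
    have := generating_frame_full genT yreg.
    by rewrite row_full_unit unitmxE unitfE -/(J y) Jy eqxx.
  have [cod|ncod] := boolP (codim1 w).
    have wr : w \in rs by rewrite mem_filter cod.
    have iw : (index w rs < size rs)%N by rewrite index_mem.
    left; exists (Ordinal iw); apply/eqP; have [_ _ <-] := lP (Ordinal iw).
    by rewrite /= nth_index //; apply/fixedSpaceP.
  have wr : w \in os by rewrite mem_filter w1 ncod.
  have iw : (index w os < size os)%N by rewrite index_mem.
  right; exists (Ordinal iw).
  by rewrite /= nth_index //; apply/fixedSpaceP.
- have [_ _ <-] := lP i; have := mem_nth 0 (ltn_ord i).
  by rewrite mem_filter => /andP[/eqP cod Ww]; exact: xreg.
Qed.

End Frame.

(** * Complex differentiability of matrix-valued maps *)

Section Differentiability.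
Variable K : numFieldType.

Lemma near_eq_differentiable (V W : normedModType K) (f g : V -> W) (x : V) :
  (\forall y \near x, f y = g y) -> differentiable f x -> differentiable g x.
Proof.
move=> fg df; have fgx : f x = g x := nbhs_singleton fg.
have dg : g \o shift x = cst (g x) + 'd f x +o_ 0 id.
  apply/eqaddoP => e e0; have /eqaddoP /(_ e e0) := diff_locally df.
  have : \forall h \near 0, f (h + x) = g (h + x).
    have [d d0 dP] := (nbhs_ballP _ _).1 fg.
    apply/nbhs_ballP; exists d => // h; rewrite -!ball_normE /= => hd.
    by apply: dP; rewrite -ball_normE /= opprD addrCA subrr addr0 -[- h]add0r.
  apply: filterS2 => h fgh.
  by rewrite [(_ - _) h]/(f (h + x) - (f x + 'd f x h)) fgh fgx.
have dfc := diff_continuous df.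
by apply/diff_locallyP; rewrite (diff_unique dfc dg).
Qed.

Lemma differentiable_bigsum (V W : normedModType K) I (r : seq I)
    (F : I -> V -> W) (x : V) :
  (forall i, differentiable (F i) x) ->
  differentiable (fun y => \sum_(i <- r) F i y) x.
Proof.
move=> dF; rewrite (_ : (fun y => _) = \sum_(i <- r) F i); last first.
  by apply/funext => y; rewrite fct_sumE.
by elim/big_ind: _ => // f g df dg; exact: differentiableD.
Qed.

Lemma differentiable_bigprod (V : normedModType K) I (r : seq I)
    (F : I -> V -> K) (x : V) :
  (forall i, differentiable (F i) x) ->
  differentiable (fun y => \prod_(i <- r) F i y) x.
Proof.
move=> dF; elim: r => [|i r IHr].
  under eq_fun do rewrite big_nil; exact: differentiable_cst.
by under eq_fun do rewrite big_cons; exact: differentiableM.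
Qed.

Lemma differentiable_mx (V : normedModType K) m n (F : V -> 'M[K]_(m, n)) (x : V) :
  (forall i j, differentiable (fun y => F y i j) x) -> differentiable F x.
Proof.
move=> dF; rewrite (_ : F = fun y => \sum_i \sum_j F y i j *: delta_mx i j).
  apply: differentiable_bigsum => i; apply: differentiable_bigsum => j.
  exact: differentiableZl.
by apply/funext => y; rewrite -matrix_sum_delta.
Qed.

Lemma differentiable_entry (V : normedModType K) m n (F : V -> 'M[K]_(m, n)) i j
    (x : V) : differentiable F x -> differentiable (fun y => F y i j) x.
Proof.
move=> dF; have dc := @differentiable_coord K m n (F x) i j.
exact: differentiable_comp dF dc.
Qed.

Lemma differentiable_det (V : normedModType K) n (F : V -> 'M[K]_n) (x : V) :
  (forall i j, differentiable (fun y => F y i j) x) ->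
  differentiable (fun y => \det (F y)) x.
Proof.
move=> dF; apply: differentiable_bigsum => s; apply: differentiableM.
  exact: differentiable_cst.
exact: differentiable_bigprod.
Qed.

Lemma differentiable_adj (V : normedModType K) n (F : V -> 'M[K]_n) (x : V) :
  (forall i j, differentiable (fun y => F y i j) x) ->
  differentiable (fun y => \adj (F y)) x.
Proof.
move=> dF; apply: differentiable_mx => i j.
under eq_fun do rewrite mxE; apply: differentiableM.
  exact: differentiable_cst.
by apply: differentiable_det => k l; under eq_fun do rewrite !mxE.
Qed.

Lemma differentiable_mulmx (V : normedModType K) m n p (F : V -> 'M[K]_(m, n))
    (G : V -> 'M[K]_(n, p)) (x : V) :
  differentiable F x -> differentiable G x -> differentiable (fun y => F y *m G y) x.
Proof.
move=> dF dG; apply: differentiable_mx => i j; under eq_fun do rewrite mxE.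
apply: differentiable_bigsum => k.
by apply: differentiableM; exact: differentiable_entry.
Qed.

Lemma differentiable_row_mx (V : normedModType K) m n p (F : V -> 'M[K]_(m, n))
    (G : V -> 'M[K]_(m, p)) (x : V) :
  differentiable F x -> differentiable G x ->
  differentiable (fun y => row_mx (F y) (G y)) x.
Proof.
move=> dF dG; apply: differentiable_mx => i j; under eq_fun do rewrite mxE.
by case: (fintype.split j) => k; exact: differentiable_entry.
Qed.

End Differentiability.

(** * Countable bases and separation *)

Section SecondCountable.

(** Bases as indexed families instead of sets of sets, so that they can be given
    by formulas. *)
Definition base_seq (T : topologicalType) (I : Type) (U : I -> set T) :=
  (forall k, open (U k)) /\
  forall x A, nbhs x A -> exists k, U k x /\ U k `<=` A.

Lemma second_countable_seq (T : topologicalType) (I : countType) (U : I -> set T) :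
  base_seq U -> @second_countable T.
Proof.
move=> [oU bU]; exists (range U).
  exact: card_le_trans (card_image_le _ _) (countableP _).
split=> [_ [k _ <-]|x A /bU[k [Ux UA]]]; first exact: oU.
by exists (U k) => //; split=> //; exists k.
Qed.

Lemma second_countable_base (T : topologicalType) : @second_countable T ->
  exists U : nat -> set T, base_seq U.
Proof.
move=> [B /countable_injP[f finj] [oB bB]].
exists (fun k => \bigcup_(b in [set b | B b /\ f b = k]) b); split=> [k|x A].
  by apply: bigcup_open => b [Bb _]; exact: oB.
move=> /(bB x)[b [Bb bx] bA]; exists (f b); split; first by exists b.
move=> y [b' [Bb' eqf] b'y]; apply: bA.
by have -> : b = b' by apply: finj => //; exact: mem_set.
Qed.

Lemma second_countable_initial (S : choiceType) (T : topologicalType) (f : S -> T) :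
  @second_countable T -> @second_countable (initial_topology f).
Proof.
move=> /second_countable_base[U [oU bU]].
apply: (@second_countable_seq (initial_topology f) nat (fun k => f @^-1` U k)).
split=> [k|x A]; first by exists (U k).
move=> [_ [[B oB <-] Bx BA]].
have /(bU _)[k [Uk UB]] : nbhs (f x) B by exact: open_nbhs_nbhs.
by exists k; split=> // y Uy; apply: BA; exact: UB.
Qed.

Lemma second_countable_prod (S T : topologicalType) :
  @second_countable S -> @second_countable T -> @second_countable (S * T)%type.
Proof.
move=> /second_countable_base[U [oU bU]] /second_countable_base[U' [oU' bU']].
apply: (@second_countable_seq _ (nat * nat)%type (fun k => U k.1 `*` U' k.2)).
split=> [k|[x y] A [[P Q] /= [Px Qy] PQA]].
  rewrite openE => -[x y] [/= Ux Uy].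
  exists (U k.1, U' k.2) => //=.
  by split; apply: open_nbhs_nbhs; split=> //=.
have [[k [Ux UP]] [k' [Uy UQ]]] := (bU _ _ Px, bU' _ _ Qy).
exists (k, k'); split=> // -[x' y'] [/= Ux' Uy'].
by apply: PQA; split; [exact: UP|exact: UQ].
Qed.

Lemma second_countable_mx (T : topologicalType) m n :
  @second_countable T -> @second_countable 'M[T]_(m, n).
Proof.
move=> /second_countable_base[U [oU bU]].
apply: (@second_countable_seq _ {ffun 'I_m * 'I_n -> nat}
  (fun f => [set A : 'M[T]_(m, n) | forall i j, U (f (i, j)) (A i j)])).
split=> [f|M A [P MP PA]].
  rewrite openE => M MU; exists (fun i j => U (f (i, j))) => // i j.
  by apply: open_nbhs_nbhs; split.
have /choice[f fP] : forall ij : 'I_m * 'I_n,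
    exists k, U k (M ij.1 ij.2) /\ U k `<=` P ij.1 ij.2.
  by move=> [i j]; apply: bU; exact: MP.
exists [ffun ij => f ij]; split=> [i j|B UB].
  by rewrite ffunE; have [] := fP (i, j).
apply: PA => i j; have := UB i j; rewrite ffunE.
by have [_] := fP (i, j); apply.
Qed.

Lemma complex_norm_le (R : realType) (x : R[i]) :
  `|x| <= ((`|complex.Re x| + `|complex.Im x|)%:C)%C.
Proof.
rewrite normc_def lecR -[leRHS]ger0_norm ?addr_ge0 // -sqrtr_sqr ler_wsqrtr //.
rewrite sqrrD !real_normK ?num_real // -addrA [X in _ <= _ + X]addrC addrA lerDl.
by rewrite mulrn_wge0 // mulr_ge0.
Qed.

Lemma second_countable_complexes (R : realType) : @second_countable (complexes R).
Proof.
pose z (ab : rat * rat) : complexes R := (ratr ab.1 +i* ratr ab.2)%C.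
pose e (k : nat) : complexes R := ((k.+1%:R^-1 : R)%:C)%C.
apply: (@second_countable_seq _ ((rat * rat) * nat)%type
  (fun abk => ball (z abk.1) (e abk.2))).
split=> [[ab k]|x A]; first exact: ball_open.
move=> /nbhs_ballP[d /= d0 dA].
have [rd dE] : exists rd : R, d = (rd%:C)%C.
  have /complex_realP[rd ->] : d \is Num.real by exact: gtr0_real.
  by exists rd.
have rd0 : 0 < rd by move: d0; rewrite dE ltcR.
have [k kd] : exists k, k.+1%:R^-1 < rd / 2.
  have [k] := ltr_add_invr (divr_gt0 rd0 (ltr0Sn R 1)).
  by rewrite add0r => ?; exists k.
have approx (y : R) : exists q : rat, `|ratr q - y| < k.+1%:R^-1 / 2.
  have h0 : 0 < k.+1%:R^-1 / 2 :> R by rewrite divr_gt0 ?invr_gt0 ?ltr0Sn.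
  have /rat_in_itvoo[q] : y - k.+1%:R^-1 / 2 < y + k.+1%:R^-1 / 2.
    by rewrite ltrD2l (lt_trans _ h0) // oppr_lt0.
  by rewrite in_itv /= => /andP[q1 q2]; exists q; rewrite ltr_distl q1.
have [[a xa] [b xb]] := (approx (complex.Re x), approx (complex.Im x)).
have zx : ball (z (a, b)) (e k) x.
  rewrite -ball_normE /= (le_lt_trans (complex_norm_le _)) //.
  rewrite /e ltcR (splitr (k.+1%:R^-1)).
  by move: xa xb; case: (x) => u v /= xa xb; exact: ltrD.
exists ((a, b), k); split=> //= y zy; apply: dA.
apply: (le_ball (e1 := e k + e k)); last exact: ball_triangle (ball_sym zx) zy.
by rewrite dE /e -rmorphD lecR (splitr rd) ltW // ltrD.
Qed.

Lemma second_countable_rV (R : realType) n : @second_countable 'rV[complexes R]_n.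
Proof. exact/second_countable_mx/second_countable_complexes. Qed.

End SecondCountable.

(** * Manifolds and their parametrizations *)

Section Parametrizations.
Variable R : realType.
Local Notation C := (complexes R).

Lemma near_seq (T : topologicalType) (I : eqType) (r : seq I) (P : I -> T -> Prop)
    (x : T) :
  {in r, forall i, \forall y \near x, P i y} ->
  \forall y \near x, forall i, i \in r -> P i y.
Proof.
elim: r => [_|i r IHr Pr]; first exact: nearW.
have Pi := Pr i (mem_head _ _).
have /IHr : {in r, forall j, \forall y \near x, P j y}.
  by move=> j jr; apply: Pr; rewrite inE jr orbT.
apply: filterS2 Pi => y Piy Pry j; rewrite inE => /predU1P[->//|]; exact: Pry.
Qed.

Lemma nbhs_open (T : topologicalType) (x : T) A : nbhs x A ->
  exists U, [/\ open U, U x & U `<=` A].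
Proof. by rewrite nbhsE => -[U [oU Ux] UA]; exists U. Qed.

Lemma nbhs_fst (S T : topologicalType) (x : S) (y : T) A :
  nbhs x A -> nbhs (x, y) (fst @^-1` A).
Proof. by move=> xA; exists (A, setT) => [|z []] //; split=> //; exact: filterT. Qed.

Lemma nbhs_snd (S T : topologicalType) (x : S) (y : T) A :
  nbhs y A -> nbhs (x, y) (snd @^-1` A).
Proof. by move=> xA; exists (setT, A) => [|z []] //; split=> //; exact: filterT. Qed.

Lemma hausdorffP (T : topologicalType) : hausdorff_space T <->
  forall x y : T, x <> y ->
    exists A B, [/\ nbhs x A, nbhs y B & forall z, A z -> B z -> False].
Proof.
split=> [hT x y xy|sep x y xy].
  apply: contrapT => nsep; apply: xy; apply: hT => A B Ax By.
  apply: contrapT => /set0P/negP; rewrite negbK => /eqP AB0; apply: nsep.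
  exists A, B; split=> // z Az Bz.
  by have : (A `&` B) z by []; rewrite AB0.
apply: contrapT => /sep[A [B [Ax By AB]]].
by have [z [/AB Az /Az]] := xy A B Ax By.
Qed.

Lemma hausdorff_inj (S T : topologicalType) (f : S -> T) :
  continuous f -> injective f -> hausdorff_space T -> hausdorff_space S.
Proof.
move=> fc finj /hausdorffP hT; apply/hausdorffP => x y xy.
have [|A [B [Ax By AB]]] := hT (f x) (f y); first by move=> /finj.
exists (f @^-1` A), (f @^-1` B); split=> [||z]; [exact: fc|exact: fc|exact: AB].
Qed.

Lemma hausdorff_prod (S T : topologicalType) :
  hausdorff_space S -> hausdorff_space T -> hausdorff_space (S * T)%type.
Proof.
move=> /hausdorffP hS /hausdorffP hT; apply/hausdorffP => -[x y] [x' y'] xy.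
have [xx'|/hS[A [B [Ax Bx AB]]]] := pselect (x = x').
  have /hT[A [B [Ay By AB]]] : y <> y' by move=> yy'; apply: xy; rewrite xx' yy'.
  exists (setT `*` A), (setT `*` B); split=> [||[u v] [_ Av] [_ Bv]].
  - by exists (setT, A) => //; split=> //; exact: filterT.
  - by exists (setT, B) => //; split=> //; exact: filterT.
  - exact: AB Av Bv.
exists (A `*` setT), (B `*` setT); split=> [||[u v] [Au _] [Bu _]].
- by exists (A, setT) => //; split=> //; exact: filterT.
- by exists (B, setT) => //; split=> //; exact: filterT.
- exact: AB Au Bu.
Qed.

(** [pi] presents [M] as a quotient of [P] by a local homeomorphism, and [kappa]
    is a global coordinate system on [P] in which the charts of [M] read as the
    identity.  Holomorphy on [M] can then be checked upstairs. *)
Definition parametrization (P : topologicalType) (M : mfd R)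
    (kappa : P -> 'rV[C]_(mfd_dim M)) (pi : P -> M) :=
  [/\ continuous kappa,
      forall q A, nbhs q A -> exists2 B, nbhs (kappa q) B & kappa @^-1` B `<=` A,
      continuous pi,
      forall q A, nbhs q A -> nbhs (pi q) (pi @` A) &
      forall p : P, exists2 c : chart R (mfd_dim M) M, mfd_atlas c &
        \forall q \near p, chart_dom c (pi q) /\ c (pi q) = kappa q].

(** Continuity of the lift [f'] at [p] comes for free: in coordinates [f'] is the
    differentiable map [g], and [kappa'] is an embedding. *)
Lemma holomorphic_lift (P P' : topologicalType) (M N : mfd R)
    (kappa : P -> 'rV[C]_(mfd_dim M)) (pi : P -> M)
    (kappa' : P' -> 'rV[C]_(mfd_dim N)) (pi' : P' -> N)
    (f : M -> N) (f' : P -> P')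
    (g : 'rV[C]_(mfd_dim M) -> 'rV[C]_(mfd_dim N)) p :
  parametrization kappa pi -> parametrization kappa' pi' ->
  (forall q, f (pi q) = pi' (f' q)) ->
  (forall q, kappa' (f' q) = g (kappa q)) ->
  (\forall z \near kappa p, differentiable g z) ->
  holomorphic_at f (pi p).
Proof.
move=> [kc _ _ po chartM] [_ ke' _ _ chartN] ff' kg dg.
have [c atlas_c cP] := chartM p; have [d atlas_d dP] := chartN (f' p).
have [cp ckp] := nbhs_singleton cP.
have f'c : f' q @[q --> p] --> f' p.
  move=> A /ke'[B kB BA]; have gkc : {for p, continuous (g \o kappa)}.
    apply: continuous_comp; first exact: kc.
    exact/differentiable_continuous/(nbhs_singleton dg).
  have : nbhs p ((g \o kappa) @^-1` B) by apply: gkc; rewrite /= -kg.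
  by apply: filterS => q Bq; apply: BA; rewrite /= kg.
exists c, d, g; split; [exact: atlas_c|exact: atlas_d|exact: cp| |]; last first.
  by rewrite ckp.
have good : \forall q \near p,
    (chart_dom c (pi q) /\ c (pi q) = kappa q) /\
    (chart_dom d (pi' (f' q)) /\ d (pi' (f' q)) = kappa' (f' q)).
  by apply: filterI; [exact: cP|exact: f'c dP].
apply: filterS (po _ _ good) => _ [q [[cq ckq] [dq dkq]] <-].
by rewrite ff' dkq kg ckq.
Qed.

Lemma holomorphic_lift_entire (P P' : topologicalType) (M N : mfd R)
    (kappa : P -> 'rV[C]_(mfd_dim M)) (pi : P -> M)
    (kappa' : P' -> 'rV[C]_(mfd_dim N)) (pi' : P' -> N)
    (f : M -> N) (f' : P -> P')
    (g : 'rV[C]_(mfd_dim M) -> 'rV[C]_(mfd_dim N)) p :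
  parametrization kappa pi -> parametrization kappa' pi' ->
  (forall q, f (pi q) = pi' (f' q)) ->
  (forall q, kappa' (f' q) = g (kappa q)) ->
  (forall z, differentiable g z) ->
  holomorphic_at f (pi p).
Proof.
move=> parM parN ff' kg dg; apply: holomorphic_lift parM parN ff' kg _.
exact: (@filterE _ (nbhs (kappa p)) _ (fun z => differentiable g z) dg).
Qed.

Lemma cvg_row_mx (T : Type) (F : set_system T) m n (f : T -> 'rV[C]_m)
    (g : T -> 'rV[C]_n) (u : 'rV[C]_m) (v : 'rV[C]_n) : Filter F ->
  f @ F --> u -> g @ F --> v -> (fun x => row_mx (f x) (g x)) @ F --> row_mx u v.
Proof.
move=> FF fu gv A [P Puv PA].
have /fu Pf : nbhs u [set w : 'rV[C]_m | forall i j, P i (lshift n j) (w i j)].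
  exists (fun i j => P i (lshift n j)) => // i j.
  by have := Puv i (lshift n j); rewrite row_mxEl.
have /gv Pg : nbhs v [set w : 'rV[C]_n | forall i j, P i (rshift m j) (w i j)].
  exists (fun i j => P i (rshift m j)) => // i j.
  by have := Puv i (rshift m j); rewrite row_mxEr.
have PfgA x : (forall i j, P i (lshift n j) (f x i j)) ->
    (forall i j, P i (rshift m j) (g x i j)) -> A (row_mx (f x) (g x)).
  move=> Pfx Pgx; apply: PA => i j.
  by rewrite -(splitK j); case: (fintype.split j) => k; rewrite /= ?row_mxEl ?row_mxEr.
change (F [set x | A (row_mx (f x) (g x))]).
apply: (@filterS2 _ F FF _ _ _ PfgA); [exact: Pf|exact: Pg].
Qed.

Lemma row_mx_nbhs m n (u : 'rV[C]_m) (v : 'rV[C]_n) A B :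
  nbhs u A -> nbhs v B ->
  \forall z \near row_mx u v, A (lsubmx z) /\ B (rsubmx z).
Proof.
move=> Au Bv; apply: filterI.
  by apply: continuous_lsubmx; rewrite /= row_mxKl.
by apply: continuous_rsubmx; rewrite /= row_mxKr.
Qed.

Lemma parametrization_prod (P P' : topologicalType) (M N : mfd R)
    (kappa : P -> 'rV[C]_(mfd_dim M)) (pi : P -> M)
    (kappa' : P' -> 'rV[C]_(mfd_dim N)) (pi' : P' -> N) :
  parametrization kappa pi -> parametrization kappa' pi' ->
  @parametrization (P * P')%type (prod_mfd M N)
    (fun q => row_mx (kappa q.1) (kappa' q.2)) (fun q => (pi q.1, pi' q.2)).
Proof.
move=> [kc ke pc po chartM] [kc' ke' pc' po' chartN]; split.
- move=> [x y]; apply: (@cvg_row_mx _ (nbhs (x, y))).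
    move=> B kB; have kB' : nbhs x (kappa @^-1` B) by exact: kc.
    exact: (nbhs_fst y kB').
  move=> B kB; have kB' : nbhs y (kappa' @^-1` B) by exact: kc'.
  exact: (nbhs_snd x kB').
- move=> [x y] A [[B B'] /= [Bx By] BA].
  have [[D kD DB] [D' kD' DB']] := (ke _ _ Bx, ke' _ _ By).
  exists [set z | D (lsubmx z) /\ D' (rsubmx z)]; first exact: row_mx_nbhs.
  move=> [x' y'] [/=]; rewrite row_mxKl row_mxKr => Dx Dy.
  by apply: BA; split; [exact: DB|exact: DB'].
- move=> [x y] A [[B B'] /= [Bx By] BA].
  exists (pi @^-1` B, pi' @^-1` B'); first by split; [exact: pc|exact: pc'].
  by move=> [x' y'] [/= Bx' By']; apply: BA.
- move=> [x y] A [[B B'] /= [Bx By] BA].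
  exists (pi @` B, pi' @` B'); first by split; [exact: po|exact: po'].
  move=> [_ _] [/= [x' Bx' <-] [y' By' <-]]; exists (x', y') => //.
  exact: BA.
- move=> [x y]; have [[c atlas_c cP] [d atlas_d dP]] := (chartM x, chartN y).
  exists (@Chart R _ (prod_mfd M N) (chart_dom c `*` chart_dom d)
           (fun x => row_mx (c x.1) (d x.2))).
    by exists c => //; exists d.
  exists ([set q | chart_dom c (pi q) /\ c (pi q) = kappa q],
          [set q | chart_dom d (pi' q) /\ d (pi' q) = kappa' q]) => //.
  by move=> [x' y'] [/= [cx ckx] [dy dky]]; split=> //=; rewrite ckx dky.
Qed.

(** Manifolds covered by one chart, such as open subsets of vector spaces. *)
Definition single_chart (M : mfd R) (kappa : M -> 'rV[C]_(mfd_dim M)) :=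
  [/\ mfd_atlas (m := M) = [set Chart setT kappa], continuous kappa,
      injective kappa, forall q A, nbhs q A -> nbhs (kappa q) (kappa @` A) &
      second_countable (T := M)].

Lemma nbhs_image_open (S T : topologicalType) (f : S -> T) U :
  (forall q A, nbhs q A -> nbhs (f q) (f @` A)) -> open U -> open (f @` U).
Proof.
move=> fo oU; rewrite openE => _ [x Ux <-]; apply: fo.
exact: open_nbhs_nbhs.
Qed.

Lemma single_chart_parametrization (M : mfd R) kappa :
  @single_chart M kappa -> @parametrization M M kappa id.
Proof.
move=> [atlasM kc kinj ko _]; split=> // [q A qA|q|q A|p].
- exists (kappa @` A); first exact: ko.
  by move=> x [y Ay /kinj <-].
- exact: cvg_id.
- by rewrite image_id.
- by exists (Chart setT kappa); [rewrite atlasM|exact: nearW].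
Qed.

Lemma single_chart_is_chart (M : mfd R) kappa :
  @single_chart M kappa -> is_chart (Chart setT kappa).
Proof.
move=> [atlasM kc kinj ko _]; split=> //=; first exact: openT.
- by move=> x y _ _; exact: kinj.
- by move=> U oU _; apply: nbhs_image_open.
Qed.

Lemma single_chart_complex_mfd (M : mfd R) kappa :
  @single_chart M kappa -> is_complex_mfd M.
Proof.
move=> scM; have [atlasM kc kinj ko scb] := scM; split=> //.
- by apply: hausdorff_inj kc kinj _; exact: norm_hausdorff.
- by rewrite atlasM => _ ->; exact: single_chart_is_chart scM.
- by move=> x; exists (Chart setT kappa); rewrite ?atlasM.
- rewrite atlasM => _ _ -> ->; exists id => x _ _; split=> //.
Qed.

(** Compatibility is a local property even though it asks for one transition map:
    injectivity of the chart [c] determines this map on the image of [c].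
    Charts of a quotient need this form, since different group elements relate
    them on different parts of their common domain. *)
Lemma compatible_near n (T : topologicalType) (c d : chart R n T) :
  is_chart c -> is_chart d ->
  (forall x, chart_dom c x -> chart_dom d x ->
     exists2 g : 'rV[C]_n -> 'rV[C]_n, differentiable g (c x) &
       \forall y \near x, d y = g (c y)) -> compatible c d.
Proof.
move=> [oc cinj _ copen] [od _ _ _] loc.
pose G (z : 'rV[C]_n) : 'rV[C]_n :=
  xget 0 [set v | exists y, [/\ chart_dom c y, chart_dom d y, c y = z & v = d y]].
have GE y : chart_dom c y -> chart_dom d y -> G (c y) = d y.
  move=> cy dy; rewrite /G; case: xgetP => [v _ [y' [cy' dy' eqc ->]]|no].
    by congr (d _); apply: cinj eqc; exact: mem_set.
  by case: (no (d y)); exists y.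
exists G => x cx dx; split; first by rewrite GE.
have [g dg gE] := loc x cx dx; apply: near_eq_differentiable dg.
have [U [oU Ux UP]] : exists U, [/\ open U, U x &
    U `<=` [set y | [/\ chart_dom c y, chart_dom d y & d y = g (c y)]]].
  apply: nbhs_open; apply: filterS3 (open_nbhs_nbhs (conj oc cx))
    (open_nbhs_nbhs (conj od dx)) gE => y cy dy ygE.
  by split.
have : nbhs (c x) (c @` U).
  apply: open_nbhs_nbhs; split; last by exists x.
  by apply: copen => // y /UP[].
by apply: filterS => _ [y /UP[cy dy ygE] <-]; rewrite GE // ygE.
Qed.

Lemma chart_nbhs n (T : topologicalType) (c : chart R n T) x A :
  is_chart c -> chart_dom c x -> nbhs x A -> nbhs (c x) (c @` A).
Proof.
move=> [oc _ _ copen] cx Ax.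
have [U [oU Ux UP]] : exists U, [/\ open U, U x & U `<=` A `&` chart_dom c].
  by apply: nbhs_open; apply: filterI Ax _; exact: open_nbhs_nbhs.
have : nbhs (c x) (c @` U).
  apply: open_nbhs_nbhs; split; last by exists x.
  by apply: copen => // y /UP[].
by apply: filterS => _ [y /UP[Ay _] <-]; exists y.
Qed.

Lemma prod_complex_mfd (M N : mfd R) :
  is_complex_mfd M -> is_complex_mfd N -> is_complex_mfd (prod_mfd M N).
Proof.
move=> [hM sM chM coM cpM] [hN sN chN coN cpN]; split.
- exact: hausdorff_prod.
- exact: second_countable_prod.
- move=> _ [c Ac [d Ad <-]]; have cc := chM c Ac; have dd := chN d Ad.
  have [oc cinj cc0 copen] := cc; have [od dinj dc0 dopen] := dd; split=> /=.
  + rewrite openE => -[x y] [/= cx dy].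
    exists (chart_dom c, chart_dom d) => //=.
    by split; apply: open_nbhs_nbhs.
  + move=> [x y] [x' y'] /set_mem[/= cx dy] /set_mem[/= cx' dy'] /eq_row_mx[ex ey].
    by congr pair; [apply: cinj|apply: dinj]; rewrite ?inE.
  + move=> [x y] /set_mem[/= cx dy]; apply: (@cvg_row_mx _ (nbhs (x, y))).
      move=> B cB; have cB' : nbhs x (c @^-1` B) by exact: cc0 (mem_set cx) _ cB.
      exact: (nbhs_fst y cB').
    move=> B dB; have dB' : nbhs y (d @^-1` B) by exact: dc0 (mem_set dy) _ dB.
    exact: (nbhs_snd x dB').
  + move=> U oU UD; rewrite openE => _ [[x y] Uxy <-] /=.
    have [/= cx dy] := UD _ Uxy.
    have [[A B] /= [Ax By] ABU] : nbhs (x, y) U by exact: open_nbhs_nbhs.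
    have cA := chart_nbhs cc cx Ax; have dB := chart_nbhs dd dy By.
    apply: filterS (row_mx_nbhs cA dB) => z [[x' Ax' ex] [y' By' ey]].
    by exists (x', y'); [exact: ABU|rewrite /= ex ey hsubmxK].
- move=> [x y]; have [[c Ac cx] [d Ad dy]] := (coM x, coN y).
  eexists; first by exists c => //; exists d => //; reflexivity.
  by [].
- move=> _ _ [c Ac [d Ad <-]] [c' Ac' [d' Ad' <-]].
  have [[g gP] [h hP]] := (cpM c c' Ac Ac', cpN d d' Ad Ad').
  exists (fun z => row_mx (g (lsubmx z)) (h (rsubmx z))) => -[x y] /=.
  move=> [/= cx dy] [/= cx' dy']; have [-> dg] := gP x cx cx'.
  have [-> dh] := hP y dy dy'; rewrite row_mxKl row_mxKr; split=> //.
  apply: differentiable_row_mx.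
    apply: (@differentiable_comp _ _ _ _ lsubmx g); last by rewrite row_mxKl.
    exact: differentiable_lsubmx.
  apply: (@differentiable_comp _ _ _ _ rsubmx h); last by rewrite row_mxKr.
  exact: differentiable_rsubmx.
Qed.

End Parametrizations.

Section ProdSingle.
Variable R : realType.
Local Notation C := (complexes R).

Lemma single_chart_prod (M N : mfd R) (kM : M -> 'rV[C]_(mfd_dim M))
    (kN : N -> 'rV[C]_(mfd_dim N)) :
  single_chart kM -> single_chart kN ->
  @single_chart R (prod_mfd M N) (fun q => row_mx (kM q.1) (kN q.2)).
Proof.
move=> sM sN; have [aM kMc kMi kMo scM] := sM; have [aN kNc kNi kNo scN] := sN.
have [kc _ _ _ _] := parametrization_prod (single_chart_parametrization sM)
  (single_chart_parametrization sN).
split; [|exact: kc| | |exact: second_countable_prod].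
- apply/seteqP; rewrite /= aM aN; split=> [c [_ -> [_ -> <-]]|_ ->] /=.
    by rewrite setXTT.
  exists (Chart setT kM) => //; exists (Chart setT kN) => //=.
  by rewrite setXTT.
- by move=> [x y] [x' y'] /= /eq_row_mx[/kMi -> /kNi ->].
- move=> [x y] A [[B B'] /= [Bx By] BA].
  apply: filterS (row_mx_nbhs (kMo _ _ Bx) (kNo _ _ By)).
  move=> z [[x' Bx' ex] [y' By' ey]].
  by exists (x', y'); [exact: BA|rewrite /= ex ey hsubmxK].
Qed.

End ProdSingle.

(** * Quotients by free actions of finite groups *)

(** The quotient structure attached to a quotient topology repackages the given
    one; its projection is the same map, but not by computation. *)
Lemma pi_quotient_topologyE (T : topologicalType) (Q : quotType T) :
  \pi_(quotient_topology Q) = \pi_Q :> (T -> Q).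
Proof. by rewrite pi.unlock; case: Q => S [[]]. Qed.

Section QuotientManifold.
Variable R : realType.
Local Notation C := (complexes R).
Variables (M : mfd R) (kappa : M -> 'rV[C]_(mfd_dim M)) (Q : quotType M).
Variables (I : eqType) (G : seq I) (act : I -> M -> M).
Variable L : I -> 'rV[C]_(mfd_dim M) -> 'rV[C]_(mfd_dim M).
Let pi : M -> quot_mfd Q := fun x => \pi_Q x.

(** A finite group acting freely on a manifold with a global chart, the
    action being holomorphic in that chart; only the orbits matter, so [G] is
    just a finite family of maps. *)
Definition free_holomorphic_action :=
  [/\ forall x y : M, \pi_Q x = \pi_Q y <-> exists2 i, i \in G & act i x = y,
      forall i x, i \in G -> kappa (act i x) = L i (kappa x),
      forall i z, i \in G -> differentiable (L i) z &
      forall i x y, i \in G -> act i x = x -> act i y = y].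

Hypothesis kappaM : single_chart kappa.
Hypothesis actM : free_holomorphic_action.

Let act_continuous i : i \in G -> continuous (act i).
Proof.
move=> Gi x A; have [_ actL Ld _] := actM.
have [kc ke _ _ _] := single_chart_parametrization kappaM.
move=> /ke[B kB BA]; have Lk : {for x, continuous (L i \o kappa)}.
  apply: continuous_comp; first exact: kc.
  exact/differentiable_continuous/Ld.
have : nbhs x ((L i \o kappa) @^-1` B) by apply: Lk; rewrite /= -actL.
by apply: filterS => y By; apply: BA; rewrite /= actL.
Qed.

Lemma quot_pi_continuous : continuous pi.
Proof. by rewrite /pi -(pi_quotient_topologyE Q); exact: pi_continuous. Qed.

(** The saturation of an open set is the union of its translates. *)
Lemma quot_pi_open U : open U -> open (pi @` U).
Proof.
move=> oU; have [orbM _ _ _] := actM.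
rewrite /open /= /quotient_open pi_quotient_topologyE.
have -> : \pi_Q @^-1` (pi @` U) =
    \bigcup_(i in [set` G]) (act i @^-1` U).
  apply/seteqP; split=> x /=.
    move=> [y Uy /esym yx]; have [i Gi ixy] := (orbM x y).1 yx.
    by exists i => //=; rewrite ixy.
  move=> [i Gi /= Uix]; exists (act i x) => //.
  by apply/esym/orbM; exists i.
apply: bigcup_open => i Gi; apply: open_comp => // x _.
exact: act_continuous.
Qed.

Lemma quot_pi_nbhs x A : nbhs x A -> nbhs (pi x) (pi @` A).
Proof.
move=> /nbhs_open[U [oU Ux UA]]; have := open_nbhs_nbhs (conj (quot_pi_open oU) _).
move=> /(_ (pi x)) nb; apply: filterS (nb _); last by exists x.
by move=> _ [y Uy <-]; exists y => //; exact: UA.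
Qed.

Lemma quot_pi_surj (b : quot_mfd Q) : exists x, pi x = b.
Proof. by exists (repr (b : Q)); exact: (reprK (b : Q)). Qed.

(** By freeness, each [act i] that moves [x] moves a whole neighborhood of [x]
    off itself; intersect these finitely many neighborhoods. *)
Lemma quot_local_section x : exists U,
  [/\ open U, U x & {in U &, injective pi}].
Proof.
have [orbM _ _ free] := actM; have [_ kc kinj _ _] := kappaM.
have hM : hausdorff_space M by have [] := single_chart_complex_mfd kappaM.
have /choice[AB ABP] : forall i, exists AB : set M * set M, act i x <> x ->
    [/\ nbhs x AB.1, nbhs (act i x) AB.2 & forall z, AB.1 z -> AB.2 z -> False].
  move=> i; have [ix|ix] := pselect (act i x = x); first by exists (setT, setT).
  have [|A [B ?]] := (hausdorffP M).1 hM x (act i x); first by move/esym.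
  by exists (A, B).
have /nbhs_open[U [oU Ux UP]] : \forall y \near x, forall i, i \in G ->
    act i x <> x -> (AB i).1 y /\ (AB i).2 (act i y).
  apply: near_seq => i Gi; have [ix|ix] := pselect (act i x = x).
    exact: nearW.
  have [Ax Bix _] := ABP i ix.
  have Bx : nbhs x (act i @^-1` (AB i).2) by exact: act_continuous Bix.
  by apply: filterS2 Ax Bx => y.
exists U; split=> // y y' /set_mem Uy /set_mem Uy' /orbM[i Gi iy].
have [ix|ix] := pselect (act i x = x); first by rewrite -iy (free i x).
have [_ _ noAB] := ABP i ix; case: (noAB y').
  by have [] := UP y' Uy' i Gi ix.
by rewrite -iy; have [] := UP y Uy i Gi ix.
Qed.

Definition quot_chart (U : set M) : chart R (mfd_dim M) (quot_mfd Q) :=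
  Chart (pi @` U) (fun b => xget 0 [set z | exists2 x, U x /\ pi x = b & z = kappa x]).

Lemma quot_chartE (U : set M) x : {in U &, injective pi} -> U x ->
  quot_chart U (pi x) = kappa x.
Proof.
move=> Uinj Ux; rewrite /=; case: xgetP => [_ _ [y [Uy yx] ->]|no].
  by congr kappa; apply: Uinj yx; exact: mem_set.
by case: (no (kappa x)); exists x.
Qed.

Lemma quot_chart_atlas (U : set M) : open U -> {in U &, injective pi} ->
  mfd_atlas (m := quot_mfd Q) (quot_chart U).
Proof.
move=> oU Uinj; have [aM _ _ _ _] := kappaM.
exists (Chart setT kappa), U; split=> //; first by rewrite aM.
by split=> // x Ux; exact: quot_chartE.
Qed.

Lemma quot_atlasP (c : chart R (mfd_dim M) (quot_mfd Q)) :
  mfd_atlas (m := quot_mfd Q) c ->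
  exists U, [/\ open U, {in U &, injective pi}, chart_dom c = pi @` U &
                forall x, U x -> c (pi x) = kappa x].
Proof.
have [aM _ _ _ _] := kappaM.
move=> [c0 [U [Ac0 oU _ Uinj [domc cE]]]]; exists U; split=> // x Ux.
by rewrite cE //; move: Ac0; rewrite aM => ->.
Qed.

Lemma quot_parametrization : @parametrization R M (quot_mfd Q) kappa pi.
Proof.
have [kc ke _ _ _] := single_chart_parametrization kappaM.
split; [exact: kc|exact: ke|exact: quot_pi_continuous|exact: quot_pi_nbhs|].
move=> x.
have [U [oU Ux Uinj]] := quot_local_section x.
exists (quot_chart U); first exact: quot_chart_atlas.
apply: filterS (open_nbhs_nbhs (conj oU Ux)) => y Uy.
by split; [exists y|exact: quot_chartE].
Qed.

Lemma quot_is_chart (c : chart R (mfd_dim M) (quot_mfd Q)) :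
  mfd_atlas (m := quot_mfd Q) c -> is_chart c.
Proof.
move=> /quot_atlasP[U [oU Uinj domc cE]]; have [_ kc kinj ko _] := kappaM.
split.
- by rewrite domc; exact: quot_pi_open.
- move=> b b' /set_mem + /set_mem; rewrite domc => -[x Ux <-] [x' Ux' <-].
  by rewrite !cE // => /kinj ->.
- move=> b /set_mem; rewrite domc => -[x Ux <-] A cA.
  have : nbhs x (U `&` kappa @^-1` A).
    apply: filterI; first exact: open_nbhs_nbhs.
    by apply: kc; rewrite -cE.
  move=> /quot_pi_nbhs; apply: filterS => _ [y [Uy Ay] <-].
  by rewrite /= cE.
- move=> O oO Odom; rewrite openE => _ [b Ob <-].
  have := Odom b Ob; rewrite domc => -[x Ux xb]; rewrite -xb cE //.
  have : nbhs x (U `&` pi @^-1` O).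
    apply: filterI; first exact: open_nbhs_nbhs.
    by apply: quot_pi_continuous; rewrite xb; exact: open_nbhs_nbhs.
  move=> /ko; apply: filterS => _ [y [Uy Oy] <-].
  by exists (pi y) => //; rewrite cE.
Qed.

(** Separate [y] from each of the finitely many points of the orbit of [x]. *)
Lemma quot_hausdorff : hausdorff_space (quot_mfd Q).
Proof.
have [orbM _ _ _] := actM.
have hM : hausdorff_space M by have [] := single_chart_complex_mfd kappaM.
apply/hausdorffP => b b'; have [[x <-] [y <-]] := (quot_pi_surj b, quot_pi_surj b').
move=> xy; have /choice[AB ABP] : forall i, exists AB : set M * set M, i \in G ->
    [/\ nbhs (act i x) AB.1, nbhs y AB.2 & forall z, AB.1 z -> AB.2 z -> False].
  move=> i; have [Gi|Gi] := boolP (i \in G); last by exists (setT, setT).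
  have [|A [B ?]] := (hausdorffP M).1 hM (act i x) y; last by exists (A, B).
  by move=> ixy; apply: xy; apply/orbM; exists i.
exists (pi @` [set z | forall i, i \in G -> (AB i).1 (act i z)]),
       (pi @` [set z | forall i, i \in G -> (AB i).2 z]); split.
- apply: quot_pi_nbhs; apply: near_seq => i Gi; apply: act_continuous => //.
  by have [] := ABP i Gi.
- apply: quot_pi_nbhs; apply: near_seq => i Gi.
  by have [] := ABP i Gi.
- move=> _ [u uA <-] [v vB /esym/orbM[i Gi iuv]].
  have [_ _ noAB] := ABP i Gi; apply: (noAB v); last exact: vB.
  by rewrite -iuv; exact: uA.
Qed.

Lemma quot_complex_mfd : is_complex_mfd (quot_mfd Q).
Proof.
have [orbM actL Ld _] := actM; have [_ kc kinj ko scM] := kappaM.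
split.
- exact: quot_hausdorff.
- have [U [oU bU]] := second_countable_base scM.
  apply: (@second_countable_seq _ nat (fun k => pi @` U k)).
  split=> [k|b A]; first exact: quot_pi_open.
  have [x <-] := quot_pi_surj b => /quot_pi_continuous/(bU x)[k [Ux UA]].
  by exists k; split=> [|_ [y Uy <-]]; [exists x|exact: UA].
- exact: quot_is_chart.
- move=> b; have [x <-] := quot_pi_surj b.
  have [U [oU Ux Uinj]] := quot_local_section x.
  by exists (quot_chart U); [exact: quot_chart_atlas|exists x].
- move=> c d Ac Ad; apply: compatible_near;
    [exact: quot_is_chart|exact: quot_is_chart|].
  have [U [oU Uinj domc cE]] := quot_atlasP Ac.
  have [U' [oU' U'inj domd dE]] := quot_atlasP Ad.
  move=> b; rewrite domc domd => -[x Ux <-] [x' Ux'] /esym/orbM[i Gi ixx'].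
  exists (L i); first exact: Ld.
  have : nbhs x (U `&` act i @^-1` U').
    apply: filterI; first exact: open_nbhs_nbhs.
    by apply: act_continuous => //; rewrite ixx'; exact: open_nbhs_nbhs.
  move=> /quot_pi_nbhs; apply: filterS => _ [y [Uy U'y] <-].
  rewrite cE // -actL // -dE //; congr (d _).
  by apply/orbM; exists i.
Qed.

End QuotientManifold.

(** * The complement of the reflection arrangement *)

Section ReflectionGroupSeq.
Variables (K : numClosedFieldType) (V : vectType K) (ws : seq 'End(V)).
Hypothesis groupW : finite_linear_group ws.

(** Pigeonhole on the powers of [w]. *)
Lemma group_elt_order w : w \in ws ->
  exists2 k : nat, (0 < k)%N & forall v, iter k w v = v.
Proof.
move=> Ww; have [uW W1 WM _] := groupW.
pose pow k := iter k (fun f : 'End(V) => (w \o f)%VF) \1%VF.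
have powW k : pow k \in ws by elim: k => //= k IHk; exact: WM.
have powE k v : pow k v = iter k w v.
  by elim: k => [|k IHk]; rewrite ?id_lfunE //= comp_lfunE IHk.
have iter_inj k : injective (iter k w).
  by elim: k => // k IHk x y /(group_inj groupW Ww)/IHk.
have : ~~ uniq [seq pow k | k <- iota 0 (size ws).+1].
  apply/negP => u; have sub : {subset [seq pow k | k <- iota 0 (size ws).+1] <= ws}.
    by move=> _ /mapP[k _ ->].
  by have := uniq_leq_size u sub; rewrite size_map size_iota ltnn.
move=> /(uniqPn \1%VF)[i [j [ij]]]; rewrite size_map size_iota => jn.
rewrite !(nth_map 0%N) ?size_iota ?nth_iota ?add0n //; try by lia.
move=> eq_pow; exists (j - i)%N; first by rewrite subn_gt0.
move=> v; apply: (iter_inj i); rewrite -iterD subnKC ?(ltnW ij) //.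
by rewrite -!powE eq_pow.
Qed.

End ReflectionGroupSeq.

Section Complement.
Variables (R : realType) (V : vectType (complexes R)) (W : reflection_group V).

Lemma reflection_group_seq : exists ws : seq 'End(V),
  finite_linear_group ws /\ forall w, refl_set W w <-> w \in ws.
Proof.
have [s sE] := (finite_seqP _).1 (refl_finite W).
have mem_s w : refl_set W w <-> w \in undup s by rewrite sE mem_undup.
have [W1 WM WV] := refl_subgroup W.
exists (undup s); split=> //; split=> [||f g /mem_s Wf /mem_s Wg|f /mem_s Wf].
- exact: undup_uniq.
- exact/mem_s.
- exact/mem_s/WM.
- by have [g Wg fg] := WV f Wf; exists g => //; exact/mem_s.
Qed.

Lemma reflection_reflection_by (s : 'End(V)) : reflection s ->
  exists l a, reflection_by l a s.
Proof.
move=> [_ _ [H dimH /subvP Hs]].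
have [m [lm [y my] mH]] := hyperplane_form dimH.
exists m, ((m y)^-1 *: (s y - y)); split=> // [|x]; first by exists y.
have /Hs/fixedSpaceP : x - (m x / m y) *: y \in H.
  rewrite mH -scaleN1r linear_formD // !(linear_formZ _ _ lm) mulN1r.
  by rewrite divfK // subrr.
rewrite linearB linearZ /= => /(canRL (subrK _)) ->.
by rewrite scalerA scalerBr addrCA addrA -addrA addrC.
Qed.

Variable ws : seq 'End(V).
Hypothesis groupW : finite_linear_group ws.
Hypothesis mem_ws : forall w, refl_set W w <-> w \in ws.

Lemma reflection_group_ind : reflection_generated ws.
Proof.
move=> G G1 GM GV Grefl w /mem_ws; have [S Srefl WE] := refl_generated W.
have [W1 WM _] := refl_subgroup W.
rewrite WE => /(_ [set f | refl_set W f /\ G f]) /=.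
move=> sm; suff [] : refl_set W w /\ G w by [].
apply: sm; split.
  split=> [//|f g [Wf Gf] [Wg Gg]|f [Wf Gf]].
    by split; [exact: WM|apply: GM => //; exact/mem_ws].
  have Wf' := (mem_ws f).1 Wf; have [Wi fK fKV] := group_inv groupW Wf'.
  exists (f^-1)%VF; first by split; [exact/mem_ws|exact: GV].
  by split; apply/lfunP => x; rewrite comp_lfunE id_lfunE ?fK ?fKV.
move=> s Ss; have Ws : refl_set W s by rewrite WE => A [_]; apply.
split=> //; have [l [a la]] := reflection_reflection_by (Srefl s Ss).
by apply: Grefl la; exact/mem_ws.
Qed.

(** An element whose fixed space is a hyperplane is a reflection. *)
Lemma complement_regular x : complement W x -> forall w, w \in ws ->
  (\dim (fixedSpace w)).+1 = \dim {:V} -> x \notin fixedSpace w.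
Proof.
move=> Xx w Ww dimw; apply/negP => xw; apply: Xx.
exists (fixedSpace w) => //; split=> //; exists w; split=> //; first exact/mem_ws.
split; [exact: group_elt_order Ww| |by exists (fixedSpace w)].
apply: contra_eqN dimw => /eqP ->.
have /vspaceP/(congr1 (fun U : {vspace V} => \dim U)) -> : fixedSpace \1%VF =i {:V}%VS.
  by move=> v; rewrite memvf; apply/fixedSpaceP; rewrite id_lfunE.
by rewrite neq_ltn ltnSn orbT.
Qed.

Lemma regular_complement x : regular_point ws x -> complement W x.
Proof.
move=> xreg [H [dimH [s [/mem_ws Ws [_ s1 _] /subvP Hs]]] /Hs/fixedSpaceP sx].
by rewrite (xreg s Ws sx) eqxx in s1.
Qed.

End Complement.

Section Coordinates.
Variables (R : realType) (V : vectType (complexes R)).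
Local Notation C := (complexes R).
Local Notation n := (\dim {:V}).

Definition coords : V -> 'rV[C]_n := passmx.rVof (vbasis {:V}).
Definition of_coords : 'rV[C]_n -> V := passmx.vecof (vbasis {:V}).

Lemma coordsK : cancel coords of_coords.
Proof. exact: (passmx.rVofK (vbasisP _)). Qed.

Lemma of_coordsK : cancel of_coords coords.
Proof. exact: (passmx.vecofK (vbasisP _)). Qed.

Lemma coords_lfun (w : 'End(V)) v :
  coords (w v) = coords v *m passmx.mxof (vbasis {:V}) (vbasis {:V}) w.
Proof. exact: (passmx.rVof_app _ (vbasisP _)). Qed.

Lemma hpoly_differentiable d (p : V -> C) (z : 'rV[C]_n) :
  hpoly d p -> differentiable (fun z => p (of_coords z) : C) z.
Proof.
elim=> {d p} [c|d p q _ IHp _ IHq|d l p ll _ IHp].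
- exact: differentiable_cst.
- exact: differentiableD.
- apply: differentiableM => //.
  rewrite (_ : (fun z => _) = fun z : 'rV[C]_n => \sum_i z 0 i * l (vbasis {:V})`_i).
    apply: differentiable_bigsum => i; apply: differentiableM.
      exact: differentiable_coord.
    exact: differentiable_cst.
  apply/funext => u; rewrite /of_coords /passmx.vecof linear_form_sum //.
  by apply: eq_bigr => i _; rewrite linear_formZ.
Qed.

(** Both the topology and the chart of [vect_mfd V] come from the same
    coordinates. *)
Lemma vect_single_chart : @single_chart R (vect_mfd V) coords.
Proof.
split; [by []|exact: initial_continuous|exact: can_inj coordsK| |].
- move=> q A [_ [[B oB <-] Bq BA]].
  have : nbhs (coords q) B by exact: open_nbhs_nbhs.
  apply: filterS => z Bz; exists (of_coords z); last exact: of_coordsK.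
  by apply: BA; rewrite /= -/(coords _) of_coordsK.
- exact/second_countable_initial/second_countable_rV.
Qed.

Lemma coord_single_chart k : @single_chart R (coord_mfd R k) id.
Proof.
split; [by []|by move=> x; exact: cvg_id|by []| |exact: second_countable_rV].
by move=> q A; rewrite image_id.
Qed.

Lemma sub_single_chart (M : mfd R) (kappa : M -> 'rV[C]_(mfd_dim M)) (A : set M) :
  single_chart kappa -> open A ->
  @single_chart R (sub_mfd A) (kappa \o set_val).
Proof.
move=> [aM kc ki ko sM] oA; split.
- apply/seteqP; rewrite /= aM; split=> [c [_ -> <-] //|_ ->].
  by exists (Chart setT kappa).
- move=> x; apply: continuous_comp; last exact: kc.
  exact: initial_continuous.
- by move=> x y /ki; exact: val_inj.
- move=> q U [_ [[B oB <-] Bq BU]].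
  have Aq : A (set_val q) by exact: set_valP.
  have : nbhs (set_val q) (A `&` B) by apply: open_nbhs_nbhs; split; [exact: openI|].
  move=> /ko; apply: filterS => _ [y [Ay By] <-].
  exists (exist _ y (mem_set Ay)) => //.
  by apply: BU; rewrite /= set_valE.
- exact: second_countable_initial.
Qed.

End Coordinates.

(** * The quotient bundle and its trivialization *)

Section QuotientBundle.
Variables (R : realType) (V : vectType (complexes R)) (W : reflection_group V).
Local Notation C := (complexes R).
Local Notation n := (\dim {:V}).
Variables (ws : seq 'End(V)) (theta : nat -> V -> V).
Hypothesis groupW : finite_linear_group ws.
Hypothesis mem_ws : forall w, refl_set W w <-> w \in ws.
Hypothesis Et : forall i, (i < n)%N -> exists d, equivariant ws d (theta i).
Hypothesis frameX : forall x, (forall w, w \in ws ->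
    (\dim (fixedSpace w)).+1 = n -> x \notin fixedSpace w) ->
  frame_mx n theta x \in unitmx.

Local Notation X := (complement_mfd W).
Local Notation XV := (prod_mfd X (vect_mfd V)).
Local Notation Theta := (frame_mx n theta).
Local Notation mx w := (passmx.mxof (vbasis {:V}) (vbasis {:V}) w).

Lemma frame_equivariant w x : w \in ws -> Theta (w x) = Theta x *m mx w.
Proof.
move=> Ww; apply/row_matrixP => i; rewrite row_mul.
have rowE y : row i (Theta y) = coords (theta i y).
  by apply/rowP => j; rewrite !mxE.
have [d [_ eq_i]] := Et (ltn_ord i).
by rewrite !rowE -coords_lfun eq_i.
Qed.

(** An element fixing [x] fixes each vector of the frame at [x]. *)
Lemma frame_unit_regular x : Theta x \in unitmx -> regular_point ws x.
Proof.
move=> ux w Ww wx; have /(congr1 (mulmx (invmx (Theta x)))) := frame_equivariant x Ww.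
rewrite wx mulKmx // mulVmx // => mxw.
apply/lfunP => v; apply: (can_inj (@coordsK _ V)).
by rewrite coords_lfun -mxw mulmx1 id_lfunE.
Qed.

(** With [frame_unit_regular], this gives Steinberg's theorem that the stabilizer
    of a point of the complement is trivial. *)
Lemma complementP x : complement W x <-> Theta x \in unitmx.
Proof.
split=> [Xx|/frame_unit_regular]; last exact: regular_complement.
exact/frameX/(complement_regular groupW mem_ws Xx).
Qed.

Lemma frame_unit (x : X) : Theta (set_val x) \in unitmx.
Proof. exact/complementP/set_valP. Qed.

Lemma differentiable_frame (z : 'rV[C]_n) i j :
  differentiable (fun z => Theta (of_coords z) i j : C) z.
Proof.
under eq_fun do rewrite mxE.
have [d [Pt _]] := Et (ltn_ord i).
apply: (hpoly_differentiable (p := fun x => coord_form j (theta i x)) (d := d)).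
exact: Pt (@coord_form_linear _ V j).
Qed.

(** Continuity of the determinant; it makes the complement open. *)
Lemma det_frame_near (z : 'rV[C]_n) : Theta (of_coords z) \in unitmx ->
  \forall y \near z, Theta (of_coords y) \in unitmx.
Proof.
rewrite unitmxE unitfE => uz.
have dd : differentiable (fun y => \det (Theta (of_coords y)) : C) z.
  by apply: differentiable_det => i j; exact: differentiable_frame.
have nz : \forall y \near z, (\det (Theta (of_coords y)) : C) != 0.
  exact: (@cvgr_neq0 C C _ (nbhs z) _ _ _ (differentiable_continuous dd) uz).
by apply: filterS nz => y; rewrite unitmxE unitfE.
Qed.

Lemma open_complement : open (complement W).
Proof.
rewrite openE => x Xx; have [kc _ _ _ _] :=
  single_chart_parametrization (vect_single_chart V).
have : nbhs x (@coords R V @^-1` [set z | Theta (of_coords z) \in unitmx]).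
  apply: kc; apply: det_frame_near; rewrite coordsK; exact/complementP.
by apply: filterS => y; rewrite /= coordsK => /complementP.
Qed.

Let kX : X -> 'rV[C]_n := @coords R V \o set_val.
Let kXV (q : XV) : 'rV[C]_(n + n) := row_mx (kX q.1) (coords q.2).

Lemma single_X : @single_chart R X kX.
Proof. exact: sub_single_chart (vect_single_chart V) open_complement. Qed.

Lemma single_XV : @single_chart R XV kXV.
Proof. exact: single_chart_prod single_X (vect_single_chart V). Qed.

(** The default value only serves elements outside of the group. *)
Definition actX (w : 'End(V)) (x : X) : X :=
  xget x [set y : X | set_val y = w (set_val x)].

Lemma actXE w x : w \in ws -> set_val (actX w x) = w (set_val x).
Proof.
move=> Ww; rewrite /actX; case: xgetP => [y _ //|no].
have Xwx : complement W (w (set_val x)).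
  apply: (regular_complement mem_ws) => h Wh hwx.
  have [_ _ WM _] := groupW; have [Wi wK wKV] := group_inv groupW Ww.
  have xreg := frame_unit_regular (frame_unit x).
  have /lfunP conj1 : (w^-1 \o (h \o w))%VF = \1%VF.
    by apply: xreg; [apply: (WM) => //; exact: WM|rewrite !comp_lfunE hwx wK].
  apply/lfunP => v; have := conj1 ((w^-1)%VF v).
  by rewrite !comp_lfunE !id_lfunE wKV => /(congr1 w); rewrite !wKV.
by case: (no (exist _ (w (set_val x)) (mem_set Xwx))).
Qed.

Definition actXV w (q : XV) : XV := (actX w q.1, w q.2 : V).

Lemma orbit_classP (x y : X) : orbit_class x = orbit_class y <->
  exists2 w, w \in ws & w (set_val x) = set_val y.
Proof.
split=> [/eqmodP/asboolP[w Ww wxy]|[w Ww wxy]]; first by exists w => //; exact/mem_ws.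
by apply/eqmodP/asboolP; exists w => //; exact/mem_ws.
Qed.

Lemma diag_orbit_classP (p q : XV) : diag_orbit_class p = diag_orbit_class q <->
  exists2 w, w \in ws & w (set_val p.1) = set_val q.1 /\ w p.2 = q.2.
Proof.
split=> [/eqmodP/asboolP[w Ww wpq]|[w Ww wpq]]; first by exists w => //; exact/mem_ws.
by apply/eqmodP/asboolP; exists w => //; exact/mem_ws.
Qed.

Lemma actX_free w x : w \in ws -> actX w x = x -> w = \1%VF.
Proof.
move=> Ww /(congr1 set_val); rewrite actXE // => wx.
exact: frame_unit_regular (frame_unit x) _ Ww wx.
Qed.

Lemma actX1 x : actX \1%VF x = x.
Proof.
by apply: val_inj; rewrite /= -!set_valE actXE ?id_lfunE //; case: groupW.
Qed.

Lemma differentiable_mulmxr k m (A : 'M[C]_(k, m)) (z : 'rV[C]_k) :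
  differentiable (fun z => z *m A) z.
Proof. by apply: differentiable_mulmx => //; exact: differentiable_cst. Qed.

Lemma orbit_free_action : free_holomorphic_action kX
  ({eq_quot (orbit_equiv W)} : quotType X) ws actX (fun w z => z *m mx w).
Proof.
split=> [x y|w x Ww|w z Ww|w x y Ww wx].
- apply: iff_trans (orbit_classP x y) _; split=> -[w Ww wxy]; exists w => //.
    by apply: val_inj; rewrite /= -!set_valE actXE.
  by rewrite -actXE // wxy.
- by rewrite /kX /= actXE // coords_lfun.
- exact: differentiable_mulmxr.
- by rewrite (actX_free Ww wx) actX1.
Qed.

Lemma diag_orbit_free_action : free_holomorphic_action kXV
  ({eq_quot (diag_orbit_equiv W)} : quotType XV) ws actXV
  (fun w z => row_mx (lsubmx z *m mx w) (rsubmx z *m mx w)).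
Proof.
split=> [p q|w p Ww|w z Ww|w [x v] [y u] Ww /= [wx _]].
- apply: iff_trans (diag_orbit_classP p q) _; split=> -[w Ww].
    move=> [w1 w2]; exists w => //; rewrite /actXV w2; case: q w1 {w2} => x v /= w1.
    by congr pair; apply: val_inj; rewrite /= -!set_valE actXE.
  by move=> <-; exists w => //; rewrite /= actXE.
- by rewrite /kXV /kX /= actXE // !coords_lfun row_mxKl row_mxKr.
- apply: differentiable_row_mx.
    apply: (@differentiable_comp _ _ _ _ lsubmx (fun z => z *m mx w)).
      exact: differentiable_lsubmx.
    exact: differentiable_mulmxr.
  apply: (@differentiable_comp _ _ _ _ rsubmx (fun z => z *m mx w)).
    exact: differentiable_rsubmx.
  exact: differentiable_mulmxr.
- by rewrite (actX_free Ww wx) /actXV /= actX1 id_lfunE.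
Qed.

Lemma orbit_complex_mfd : is_complex_mfd (orbit_mfd W).
Proof. exact: quot_complex_mfd single_X orbit_free_action. Qed.

Lemma diag_orbit_complex_mfd : is_complex_mfd (diag_orbit_mfd W).
Proof. exact: quot_complex_mfd single_XV diag_orbit_free_action. Qed.

Lemma orbit_parametrization :
  @parametrization R X (orbit_mfd W) kX (@orbit_class R V W).
Proof. exact: quot_parametrization single_X orbit_free_action. Qed.

Lemma diag_orbit_parametrization :
  @parametrization R XV (diag_orbit_mfd W) kXV (@diag_orbit_class R V W).
Proof. exact: quot_parametrization single_XV diag_orbit_free_action. Qed.

Lemma orbit_class_surj (b : orbit_mfd W) : exists x, b = orbit_class x.
Proof. by exists (repr b); rewrite /orbit_class reprK. Qed.

Lemma diag_orbit_class_surj (e : diag_orbit_mfd W) :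
  exists x (v : V), e = diag_orbit_class (x, v).
Proof.
exists (repr e).1, (repr e).2.
by rewrite -surjective_pairing /diag_orbit_class reprK.
Qed.

(** [fiber_coords x v] is the row of coordinates of [v] in the basis
    [theta i x], with inverse [fiber_vector x]. *)
Definition fiber_coords (x : X) (v : V) : 'rV[C]_n :=
  coords v *m invmx (Theta (set_val x)).

Definition fiber_vector (x : X) (z : 'rV[C]_n) : V :=
  of_coords (z *m Theta (set_val x)).

Lemma fiber_vectorK x : cancel (fiber_vector x) (fiber_coords x).
Proof.
by move=> z; rewrite /fiber_coords /fiber_vector of_coordsK mulmxK ?frame_unit.
Qed.

Lemma fiber_coordsK x : cancel (fiber_coords x) (fiber_vector x).
Proof.
by move=> v; rewrite /fiber_coords /fiber_vector mulmxKV ?frame_unit ?coordsK.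
Qed.

Lemma fiber_vector_equivariant w (x y : X) z : w \in ws ->
  w (set_val x) = set_val y -> fiber_vector y z = w (fiber_vector x z).
Proof.
move=> Ww wxy; apply: (can_inj (@coordsK _ V)); rewrite coords_lfun !of_coordsK.
by rewrite -wxy frame_equivariant // mulmxA.
Qed.

Lemma fiber_coords_invariant w (x y : X) v : w \in ws ->
  w (set_val x) = set_val y -> fiber_coords y (w v) = fiber_coords x v.
Proof.
move=> Ww wxy; apply: (can_inj (fiber_vectorK y)); rewrite fiber_coordsK.
by rewrite (fiber_vector_equivariant _ Ww wxy) fiber_coordsK.
Qed.

Lemma coordsD u v : coords (u + v) = coords u + coords v :> 'rV[C]_n.
Proof. by apply/rowP => j; rewrite !mxE linearD. Qed.

Lemma coordsZ a v : coords (a *: v) = a *: coords v :> 'rV[C]_n.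
Proof. by apply/rowP => j; rewrite !mxE linearZ. Qed.

Lemma fiber_coordsD x u v :
  fiber_coords x (u + v) = fiber_coords x u + fiber_coords x v.
Proof. by rewrite /fiber_coords coordsD mulmxDl. Qed.

Lemma fiber_coordsZ x a v : fiber_coords x (a *: v) = a *: fiber_coords x v.
Proof. by rewrite /fiber_coords coordsZ scalemxAl. Qed.

Local Notation E := (quotient_vbundle W).
Local Notation F := (trivial_vbundle (orbit_mfd W) V).

(** The isomorphism sends [[x, v]] to the orbit of [x] and the vector with the
    same coordinates in the fixed basis of [V] as [v] has in the frame at
    [x]. *)
Definition to_trivial (e : E) : F :=
  (orbit_class (repr e).1, of_coords (fiber_coords (repr e).1 (repr e).2)).

Definition of_trivial (f : F) : E :=
  diag_orbit_class (repr f.1, fiber_vector (repr f.1) (coords f.2)).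

Lemma to_trivialE (x : X) (v : V) : to_trivial (diag_orbit_class (x, v)) =
  (orbit_class x, of_coords (fiber_coords x v)).
Proof.
rewrite /to_trivial; case eqr : (repr _) => [y u] /=.
have /diag_orbit_classP[w Ww [/= wx wv]] :
    diag_orbit_class (y, u) = diag_orbit_class (x, v).
  by rewrite -eqr /diag_orbit_class reprK.
congr pair; first by apply/orbit_classP; exists w.
by rewrite -(fiber_coords_invariant u Ww wx) wv.
Qed.

Lemma of_trivialE (x : X) (v : V) : of_trivial (orbit_class x, v) =
  diag_orbit_class (x, fiber_vector x (coords v)).
Proof.
rewrite /of_trivial /=; set y := repr _.
have /orbit_classP[w Ww wyx] : orbit_class y = orbit_class x.
  by rewrite /y /orbit_class reprK.
apply/diag_orbit_classP; exists w => //=; split=> //.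
by rewrite (fiber_vector_equivariant _ Ww wyx).
Qed.

Lemma to_trivialK : cancel to_trivial of_trivial.
Proof.
move=> e; have [x [v ->]] := diag_orbit_class_surj e.
by rewrite to_trivialE of_trivialE of_coordsK fiber_coordsK.
Qed.

Lemma of_trivialK : cancel of_trivial to_trivial.
Proof.
move=> [b v]; have [x ->] := orbit_class_surj b.
by rewrite of_trivialE to_trivialE fiber_vectorK coordsK.
Qed.

Lemma quotient_projE (p : XV) : vb_proj (v := E) (diag_orbit_class p) = orbit_class p.1.
Proof.
rewrite /=; apply/orbit_classP.
have /diag_orbit_classP[w Ww [wp _]] :
    diag_orbit_class (repr (diag_orbit_class p)) = diag_orbit_class p.
  by rewrite /diag_orbit_class reprK.
by exists w.
Qed.

Lemma quotient_scaleE a (x : X) (v : V) :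
  vb_scale (v := E) a (diag_orbit_class (x, v)) = diag_orbit_class (x, a *: v).
Proof.
rewrite /=; case eqr : (repr _) => [y u] /=.
have /diag_orbit_classP[w Ww [/= wx wv]] :
    diag_orbit_class (y, u) = diag_orbit_class (x, v).
  by rewrite -eqr /diag_orbit_class reprK.
by apply/diag_orbit_classP; exists w => //=; rewrite linearZ /= wv.
Qed.

(** The addition picks a representative of the second class over the point [y]
    chosen for the first one; the two group elements carrying [y] to [x] act
    in the same way on the fibre, as both preserve the coordinates in the
    frame. *)
Lemma quotient_addE (x : X) (u v : V) :
  vb_add (v := E) (diag_orbit_class (x, u)) (diag_orbit_class (x, v)) =
  diag_orbit_class (x, u + v).
Proof.
rewrite /=; case eqr : (repr _) => [y u'] /=.
have /diag_orbit_classP[w Ww [/= wx wv]] :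
    diag_orbit_class (y, u') = diag_orbit_class (x, u).
  by rewrite -eqr /diag_orbit_class reprK.
case: xgetP => [v' _ /diag_orbit_classP[h Wh [/= hx hv]]|no]; last first.
  have [_ wK wKV] := group_inv groupW Ww.
  case: (no ((w^-1)%VF v)); apply/diag_orbit_classP; exists w => //=.
have hw : h v' = w v'.
  apply: (can_inj (fiber_coordsK x)).
  by rewrite (fiber_coords_invariant _ Wh hx) (fiber_coords_invariant _ Ww wx).
by apply/diag_orbit_classP; exists w => //=; rewrite linearD /= wv -hw hv.
Qed.

Lemma same_fiber (e e' : E) : vb_proj e = vb_proj e' ->
  exists x (u v : V), e = diag_orbit_class (x, u) /\ e' = diag_orbit_class (x, v).
Proof.
have [x [u ->]] := diag_orbit_class_surj e.
have [y [v ->]] := diag_orbit_class_surj e'.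
rewrite !quotient_projE => /esym/orbit_classP[w Ww wyx].
exists x, u, (w v); split=> //; apply/diag_orbit_classP.
by exists w.
Qed.

(* The same maps read in the coordinates [row_mx (kX x) u] of [(x, u)]. *)
Let Th (z : 'rV[C]_(n + n)) := Theta (of_coords (lsubmx z)).

Lemma differentiable_Th (z : 'rV[C]_(n + n)) i j :
  differentiable (fun z => Th z i j : C) z.
Proof.
apply: (@differentiable_comp _ _ _ _ lsubmx
  (fun y : 'rV[C]_n => Theta (of_coords y) i j : C)).
  exact: differentiable_lsubmx.
exact: differentiable_frame.
Qed.

Let fiber_vector_mx z := rsubmx z *m Th z.
(* The adjugate formula for the inverse is differentiable near the complement. *)
Let fiber_coords_mx z := rsubmx z *m ((\det (Th z))^-1 *: \adj (Th z)).

Lemma differentiable_fiber_vector (z : 'rV[C]_(n + n)) :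
  differentiable fiber_vector_mx z.
Proof.
apply: differentiable_mulmx; first exact: differentiable_rsubmx.
by apply: differentiable_mx => i j; exact: differentiable_Th.
Qed.

Lemma differentiable_fiber_coords (x : X) (u : 'rV[C]_n) :
  \forall z \near row_mx (kX x) u, differentiable fiber_coords_mx z.
Proof.
have near_unit : \forall z \near row_mx (kX x) u, Th z \in unitmx.
  have near_x : nbhs (kX x) [set y | Theta (of_coords y) \in unitmx].
    by apply: det_frame_near; rewrite coordsK frame_unit.
  have near_u : nbhs u setT by exact: filterT.
  by apply: filterS (row_mx_nbhs near_x near_u) => z [].
apply: filterS near_unit => z; rewrite unitmxE unitfE => uz.
apply: differentiable_mulmx; first exact: differentiable_rsubmx.
have dTh i j := differentiable_Th z i j.
apply: differentiable_mx => i j; under eq_fun do rewrite mxE.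
apply: differentiableM.
  by apply: differentiableV => //; exact: differentiable_det.
by apply: differentiable_entry; exact: differentiable_adj.
Qed.

Lemma fiber_vector_mxE x z :
  coords (fiber_vector x z) = fiber_vector_mx (row_mx (kX x) z).
Proof.
by rewrite /fiber_vector_mx /Th row_mxKl row_mxKr /kX /= coordsK of_coordsK.
Qed.

Lemma fiber_coords_mxE x v :
  fiber_coords x v = fiber_coords_mx (row_mx (kX x) (coords v)).
Proof.
rewrite /fiber_coords_mx /Th row_mxKl row_mxKr /kX /= coordsK /fiber_coords.
by rewrite /invmx frame_unit.
Qed.

Let parV := single_chart_parametrization (vect_single_chart V).
Let parC := single_chart_parametrization (coord_single_chart R n).
Let parB := orbit_parametrization.
Let parE := diag_orbit_parametrization.
Let parF := parametrization_prod parB parV.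
Let parBC := parametrization_prod parB parC.

Lemma to_trivial_holomorphic : holomorphic to_trivial.
Proof.
move=> e; have [x [v ->]] := diag_orbit_class_surj e.
pose f' (q : XV) : XV := (q.1, of_coords (fiber_coords q.1 q.2)).
pose g (z : 'rV[C]_(n + n)) := row_mx (lsubmx z) (fiber_coords_mx z).
apply: (@holomorphic_lift R XV XV (diag_orbit_mfd W)
  (prod_mfd (orbit_mfd W) (vect_mfd V)) _ _ _ _ to_trivial f' g (x, v) parE parF).
- by move=> [y u]; rewrite to_trivialE.
- move=> [y u]; rewrite /kXV /g /= of_coordsK row_mxKl.
  by rewrite fiber_coords_mxE.
- apply: filterS (differentiable_fiber_coords x (coords v)) => z dz.
  by apply: differentiable_row_mx => //; exact: differentiable_lsubmx.
Qed.

Lemma differentiable_base_fiber_vector (z : 'rV[C]_(n + n)) :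
  differentiable (fun z => row_mx (lsubmx z) (fiber_vector_mx z)) z.
Proof.
apply: differentiable_row_mx; first exact: differentiable_lsubmx.
exact: differentiable_fiber_vector.
Qed.

Lemma of_trivial_holomorphic : holomorphic of_trivial.
Proof.
move=> [b v]; have [x ->] := orbit_class_surj b.
pose f' (q : XV) : XV := (q.1, fiber_vector q.1 (coords q.2)).
pose g (z : 'rV[C]_(n + n)) := row_mx (lsubmx z) (fiber_vector_mx z).
apply: (@holomorphic_lift_entire R XV XV (prod_mfd (orbit_mfd W) (vect_mfd V))
  (diag_orbit_mfd W) _ _ _ _ of_trivial f' g (x, v) parF parE).
- by move=> [y u]; rewrite of_trivialE.
- by move=> [y u]; rewrite /kXV /g /= row_mxKl fiber_vector_mxE.
- by move=> z; exact: differentiable_base_fiber_vector.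
Qed.

Lemma quotient_proj_holomorphic : holomorphic (@vb_proj _ _ E).
Proof.
move=> e; have [x [v ->]] := diag_orbit_class_surj e.
apply: (@holomorphic_lift_entire R XV X (diag_orbit_mfd W) (orbit_mfd W) _ _ _ _
  (@vb_proj _ _ E) fst lsubmx (x, v) parE parB).
- by move=> q; rewrite quotient_projE.
- by move=> [y u]; rewrite /kXV row_mxKl.
- by move=> z; exact: differentiable_lsubmx.
Qed.

Definition quotient_phi (e : E) : coord_mfd R n := coords (to_trivial e).2.

Definition quotient_psi (bz : prod_mfd (orbit_mfd W) (coord_mfd R n)) : E :=
  of_trivial (bz.1, of_coords bz.2).

Lemma quotient_phiE x v : quotient_phi (diag_orbit_class (x, v)) = fiber_coords x v.
Proof. by rewrite /quotient_phi to_trivialE of_coordsK. Qed.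

Lemma quotient_psiE x z :
  quotient_psi (orbit_class x, z) = diag_orbit_class (x, fiber_vector x z).
Proof. by rewrite /quotient_psi /= of_trivialE of_coordsK. Qed.

Lemma quotient_phi_holomorphic : holomorphic quotient_phi.
Proof.
move=> e; have [x [v ->]] := diag_orbit_class_surj e.
apply: (@holomorphic_lift R XV 'rV[C]_n (diag_orbit_mfd W) (coord_mfd R n) _ _ _ _
  quotient_phi (fun q => fiber_coords q.1 q.2) fiber_coords_mx (x, v) parE parC).
- by move=> [y u]; rewrite quotient_phiE.
- by move=> [y u]; rewrite /kXV /= fiber_coords_mxE.
- exact: differentiable_fiber_coords.
Qed.

Lemma quotient_psi_holomorphic : holomorphic quotient_psi.
Proof.
move=> [b z]; have [x ->] := orbit_class_surj b.
pose f' (q : (X * 'rV[C]_n)%type) : XV := (q.1, fiber_vector q.1 q.2).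
pose g (z : 'rV[C]_(n + n)) := row_mx (lsubmx z) (fiber_vector_mx z).
apply: (@holomorphic_lift_entire R (X * 'rV[C]_n)%type XV
  (prod_mfd (orbit_mfd W) (coord_mfd R n)) (diag_orbit_mfd W) _ _ _ _
  quotient_psi f' g (x, z) parBC parE).
- by move=> [y u]; rewrite quotient_psiE.
- by move=> [y u]; rewrite /kXV /g /= row_mxKl fiber_vector_mxE.
- by move=> z'; exact: differentiable_base_fiber_vector.
Qed.

Lemma quotient_vbundle_holomorphic : is_holomorphic_vbundle E.
Proof.
split.
- by split; [exact: orbit_complex_mfd|exact: diag_orbit_complex_mfd].
- exact: quotient_proj_holomorphic.
- move=> e e' /same_fiber[x [u [v [-> ->]]]].
  by rewrite quotient_addE !quotient_projE.
- move=> a e; have [x [v ->]] := diag_orbit_class_surj e.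
  by rewrite quotient_scaleE !quotient_projE.
- move=> b; exists setT, quotient_phi, quotient_psi; split=> //; first exact: openT.
  split.
  + move=> e _; split; first exact: quotient_phi_holomorphic.
    have [x [v ->]] := diag_orbit_class_surj e.
    by rewrite quotient_projE quotient_phiE quotient_psiE fiber_coordsK.
  + move=> b' z _; split; first exact: quotient_psi_holomorphic.
      have [x ->] := orbit_class_surj b'.
      by rewrite quotient_psiE quotient_projE.
    by rewrite /quotient_phi /quotient_psi of_trivialK /= of_coordsK.
  + move=> e e' _ /same_fiber[x [u [v [-> ->]]]].
    by rewrite quotient_addE !quotient_phiE fiber_coordsD.
  + move=> a e _; have [x [v ->]] := diag_orbit_class_surj e.
    by rewrite quotient_scaleE !quotient_phiE fiber_coordsZ.
Qed.

Definition trivial_phi (f : F) : coord_mfd R n := coords f.2.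

Definition trivial_psi (bz : prod_mfd (orbit_mfd W) (coord_mfd R n)) : F :=
  (bz.1, of_coords bz.2).

Lemma trivial_vbundle_holomorphic : is_holomorphic_vbundle F.
Proof.
split=> //.
- split; first exact: orbit_complex_mfd.
  apply: prod_complex_mfd; first exact: orbit_complex_mfd.
  exact: single_chart_complex_mfd (vect_single_chart V).
- move=> [b v]; have [x ->] := orbit_class_surj b.
  apply: (@holomorphic_lift_entire R XV X (prod_mfd (orbit_mfd W) (vect_mfd V))
    (orbit_mfd W) _ _ _ _ fst fst lsubmx (x, v) parF parB) => //.
    by move=> [y u]; rewrite row_mxKl.
  by move=> z; exact: differentiable_lsubmx.
- move=> b; exists setT, trivial_phi, trivial_psi; split=> //; first exact: openT.
  split.
  + move=> [b' v] _; split; last by rewrite /trivial_psi /trivial_phi /= coordsK.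
    have [x ->] := orbit_class_surj b'.
    apply: (@holomorphic_lift_entire R XV 'rV[C]_n (prod_mfd (orbit_mfd W) (vect_mfd V))
      (coord_mfd R n) _ _ _ _ trivial_phi (fun q => coords q.2) rsubmx (x, v) parF parC).
    * by [].
    * by move=> [y u]; rewrite row_mxKr.
    * by move=> z; exact: differentiable_rsubmx.
  + move=> b' z _; split=> //; last by rewrite /trivial_phi /= of_coordsK.
    have [x ->] := orbit_class_surj b'.
    apply: (@holomorphic_lift_entire R (X * 'rV[C]_n)%type XV
      (prod_mfd (orbit_mfd W) (coord_mfd R n)) (prod_mfd (orbit_mfd W) (vect_mfd V))
      _ _ _ _ trivial_psi (fun q => (q.1, of_coords q.2)) id (x, z) parBC parF).
    * by [].
    * by move=> [y u]; rewrite /= of_coordsK.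
    * by move=> z'.
  + by move=> [b1 u] [b2 v] _ _; rewrite /trivial_phi /= coordsD.
  + by move=> a [b1 u] _; rewrite /trivial_phi /= coordsZ.
Qed.

Lemma quotient_vbundle_trivial : holomorphically_equivalent E F.
Proof.
split; [exact: quotient_vbundle_holomorphic|exact: trivial_vbundle_holomorphic|].
exists to_trivial, of_trivial; split.
- by split; [exact: to_trivialK|exact: of_trivialK].
- by split; [exact: to_trivial_holomorphic|exact: of_trivial_holomorphic].
- move=> e; have [x [v ->]] := diag_orbit_class_surj e.
  by rewrite to_trivialE quotient_projE.
- move=> e e' /same_fiber[x [u [v [-> ->]]]]; rewrite quotient_addE !to_trivialE /=.
  congr pair; apply: (can_inj (@coordsK _ V)).
  by rewrite coordsD !of_coordsK fiber_coordsD.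
- move=> a e; have [x [v ->]] := diag_orbit_class_surj e.
  rewrite quotient_scaleE !to_trivialE /=.
  congr pair; apply: (can_inj (@coordsK _ V)).
  by rewrite coordsZ !of_coordsK fiber_coordsZ.
Qed.

End QuotientBundle.

Theorem proposition3p3 (R : realType) (V : vectType (complexes R))
    (W : reflection_group V) :
  holomorphically_equivalent
    (quotient_vbundle W) (trivial_vbundle (orbit_mfd W) V).
Proof.
have [ws [groupW mem_ws]] := reflection_group_seq W.
have [theta [Et frameX]] :=
  equivariant_frame_exists groupW (reflection_group_ind groupW mem_ws).
exact: quotient_vbundle_trivial groupW mem_ws Et frameX.
Qed.
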